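(* Let $k$ be a perfect field, $X$ a smooth projective variety over $k$, $D \subset X$ an effective Cartier divisor such that the irreducible components of $D_{\mathrm{red}}$ are regular, and $U = X \setminus D$. Let $\lambda_{X|D} \colon \mathrm{CH}_0(X|D) \to H^{sus}_0(U)$ be the canonical surjection. (1) If $\mathrm{char}(k) = p > 0$, then $$\lambda_{X|D} \colon \mathrm{CH}_0(X|D)[\tfrac{1}{p}] \to H^{sus}_0(U)[\tfrac{1}{p}]$$ is an isomorphism. (2) If $\mathrm{char}(k) = 0$, then $$\lambda_{X|D} \colon \mathrm{CH}_0(X|D)/m \to H^{sus}_0(U)/m$$ is an isomorphism for every integer $m \neq 0$.
   Context: Chow group with modulus: Let $\mathcal{Z}_0(X,D)=\mathcal{Z}_0(U)$ be the free abelian group on the closed points of $U = X\setminus D$. For an integral normal curve $C$ over $k$ and an effective Cartier divisor $E$ on $C$, let $\mathcal{O}_{C,E}$ be the semilocal ring of $C$ at the points of the support of $E$ (equal to the function field $k(C)$ if $E=\emptyset$) and let $G(C,E) = \ker(\mathcal{O}_{C,E}^\times \to \mathcal{O}_E^\times)$. Then $\mathrm{CH}_0(X|D)$ is the quotient of $\mathcal{Z}_0(X,D)$ by the subgroup generated by all $(\phi_C)_*(\mathrm{div}(f))$, where $\phi_C \colon C \to X$ runs over finite morphisms from integral normal curves with $\phi_C(C)\not\subset D$ and $f \in G(C,\phi_C^*(D))$. Suslin homology: $H_0^{sus}(U)$ is the quotient of $\mathcal{Z}_0(U)$ by the subgroup generated by all $i_*\phi_*(\mathrm{div}(f))$, where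 $i\colon C \hookrightarrow U$ is an integral closed curve, $\phi\colon C^N \to C$ its normalization, $\overline{C}^N$ the normal projective compactification of $C^N$, $C_\infty = \overline{C}^N \setminus C^N$ considered as a reduced divisor, and $f \in G(\overline{C}^N, C_\infty)$. The map $\lambda_{X|D}$ is the surjection induced by the identity map of $\mathcal{Z}_0(X,D) = \mathcal{Z}_0(U)$. *)

(* Defs.v *)
From HB Require Import structures.
From mathcomp Require Export all_boot all_order all_algebra.
From mathcomp Require Export ring_quotient separable.
From mathcomp Require Export boolp classical_sets functions cardinality fsbigop.
From mathcomp Require Export freeg mpoly.
From mathcomp Require Import zify.

Set Implicit Arguments.
Unset Strict Implicit.
Unset Printing Implicit Defensive.

Import GRing.Theory Num.Theory.
Local Open Scope ring_scope.
Local Open Scope classical_set_scope.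

Section Span.
Variable V : zmodType.

Definition subgroup_span (A : set V) : {pred V} := fun z =>
  `[< forall H : set V, H 0 -> (forall x y, H x -> H y -> H (x - y)) ->
        A `<=` H -> H z >].

Lemma subgroup_span_zmod_closed (A : set V) : zmod_closed (subgroup_span A).
Proof.
have spanP z : reflect (forall H : set V, H 0 ->
    (forall x y, H x -> H y -> H (x - y)) -> A `<=` H -> H z)
  (z \in subgroup_span A) by exact: asboolP.
split; first by apply/spanP .
move=> x y /spanP hx /spanP hy; apply/spanP => H H0 HB HA.
by apply: (HB); [exact: (hx H H0 HB HA) | exact: (hy H H0 HB HA)].
Qed.

HB.instance Definition _ (A : set V) :=
  GRing.isZmodClosed.Build V (subgroup_span A) (subgroup_span_zmod_closed A).

Definition span_quot (A : set V) : zmodType :=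
  Quotient.quot (subgroup_span A).

Definition span_proj (A : set V) (x : V) : span_quot A :=
  (\pi_(Quotient.quot (subgroup_span A)) x)%qT.

Definition span_repr (A : set V) (x : span_quot A) : V :=
  generic_quotient.repr (x : Quotient.quot (subgroup_span A)).

End Span.

Definition mod_int (m : int) (V : zmodType) : zmodType :=
  span_quot [set x : V | exists y : V, x = y *~ m].

Definition mod_int_map (m : int) (V W : zmodType) (f : {additive V -> W})
    (x : mod_int m V) : mod_int m W :=
  span_proj _ (f (span_repr x)).

(* V[1/p]: the pair (a, i) stands for the fraction a / p ^ i *)
Section Localization.
Variables (p : nat) (V : zmodType).

Definition frac_eq : rel (V * nat) := fun x y =>
  `[< exists r : nat, x.1 *+ p ^ (r + y.2) = y.1 *+ p ^ (r + x.2) >].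

Lemma frac_eq_refl : reflexive frac_eq.
Proof. by move=> x; apply/asboolP; exists 0. Qed.

Lemma frac_eq_sym : ssrbool.symmetric frac_eq.
Proof. by move=> x y; apply/asboolP/asboolP => -[r hr]; exists r. Qed.

Lemma frac_eq_trans : transitive frac_eq.
Proof.
move=> y x z /asboolP [r hr] /asboolP [s hs]; apply/asboolP.
exists (r + s + y.2)%N.
have -> : (r + s + y.2 + z.2 = (r + y.2) + (s + z.2))%N.
  by lia.
have -> : (r + s + y.2 + x.2 = (s + y.2) + (r + x.2))%N.
  by lia.
rewrite (expnD _ (r + y.2)) mulrnA hr -mulrnA mulnC mulrnA hs.
by rewrite -mulrnA -expnD.
Qed.

Canonical frac_equiv :=
  EquivRel frac_eq frac_eq_refl frac_eq_sym frac_eq_trans.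
Canonical frac_equiv_direct := defaultEncModRel frac_eq.

Definition localization := {eq_quot frac_eq}%qT.

HB.instance Definition _ := Choice.on localization.
HB.instance Definition _ := Quotient.on localization.
HB.instance Definition _ : EqQuotient _ frac_eq localization :=
  EqQuotient.on localization.

Definition frac (a : V) (i : nat) : localization := (\pi_localization (a, i))%qT.

Definition num (x : localization) : V := (generic_quotient.repr x).1.
Definition den (x : localization) : nat := (generic_quotient.repr x).2.

Lemma fracK x : frac (num x) (den x) = x.
Proof. by rewrite /frac /num /den -surjective_pairing reprK. Qed.

Lemma fracP a i b j :
  (frac a i = frac b j) <->
  (exists r : nat, a *+ p ^ (r + j) = b *+ p ^ (r + i)).
Proof.
split; first by move/eqmodP => /asboolP.
by move=> h; apply/eqmodP/asboolP.
Qed.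

Definition loc_add (x y : localization) : localization :=
  frac (num x *+ p ^ den y + num y *+ p ^ den x) (den x + den y).
Definition loc_opp (x : localization) : localization := frac (- num x) (den x).

Lemma loc_addE a i b j :
  loc_add (frac a i) (frac b j) = frac (a *+ p ^ j + b *+ p ^ i) (i + j).
Proof.
set x := frac a i; set y := frac b j.
have /fracP [r hr] : frac (num x) (den x) = frac a i by exact: fracK.
have /fracP [s hs] : frac (num y) (den y) = frac b j by exact: fracK.
apply/fracP; exists (r + s)%N; rewrite !mulrnDl -!mulrnA -!expnD; congr (_ + _).
  have -> : (den y + (r + s + (i + j)) = (r + i) + (s + den y + j))%N.
    by lia.
  have -> : (j + (r + s + (den x + den y)) = (r + den x) + (s + den y + j))%N.
    by lia.
  by rewrite (expnD _ (r + i)) (expnD _ (r + den x)) !mulrnA hr.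
have -> : (den x + (r + s + (i + j)) = (s + j) + (r + i + den x))%N.
  by lia.
have -> : (i + (r + s + (den x + den y)) = (s + den y) + (r + i + den x))%N.
  by lia.
by rewrite (expnD _ (s + j)) (expnD _ (s + den y)) !mulrnA hs.
Qed.

Lemma loc_oppE a i : loc_opp (frac a i) = frac (- a) i.
Proof.
have /fracP [r hr] : frac (num (frac a i)) (den (frac a i)) = frac a i.
  exact: fracK.
by apply/fracP; exists r; rewrite !mulNrn hr.
Qed.

Lemma loc_addA : associative loc_add.
Proof.
move=> x y z; rewrite -[x]fracK -[y]fracK -[z]fracK !loc_addE addnA.
congr frac; rewrite !mulrnDl -!mulrnA -!expnD addrA.
by rewrite (addnC (den z) (den x)) (addnC (den x) (den y)) (addnC (den y) (den z))
  (addnC (den y) (den x)).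
Qed.

Lemma loc_addC : commutative loc_add.
Proof.
by move=> x y; rewrite -[x]fracK -[y]fracK !loc_addE addrC addnC.
Qed.

Lemma loc_add0 : left_id (frac 0 0%N) loc_add.
Proof. by move=> x; rewrite -[x]fracK loc_addE mul0rn add0r add0n. Qed.

Lemma loc_addN : left_inverse (frac 0 0%N) loc_opp loc_add.
Proof.
move=> x; rewrite -[x]fracK loc_oppE loc_addE mulNrn addNr.
by apply/fracP; exists 0; rewrite !mul0rn.
Qed.

HB.instance Definition _ :=
  GRing.isZmodule.Build localization loc_addA loc_addC loc_add0 loc_addN.

End Localization.

Definition localization_map (p : nat) (V W : zmodType) (f : {additive V -> W})
    (x : localization p V) : localization p W :=
  frac p (f (num x)) (den x).

Definition group_isomorphism (V W : zmodType) (f : V -> W) : Prop :=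
  zmod_morphism f /\ bijective f.

Definition perfect_field (k : fieldType) : Prop :=
  forall q : {poly k}, irreducible_poly q -> separable_poly q.

(* Closed subschemes of P^n over k.  A closed subscheme is given by a     *)
(* homogeneous ideal of k[x_0, ..., x_n]; the points of the scheme P^n    *)
(* are the homogeneous primes not containing all the x_i, and x lies on   *)
(* the subscheme of I when I is contained in x.                           *)

Section Projective.
Variables (k : fieldType) (n : nat).
Local Notation S := {mpoly k[n.+1]}.
Implicit Types (I J Q x : set S) (g h s : S).

Definition homog_of (d : nat) : set S := [set g | g \is d.-homog].

Definition is_homog : set S := [set g | exists d, homog_of d g].

Definition homog_component (d : nat) g : S := pihomog mdeg d g.

Definition homogeneous_ideal I : Prop :=
  [/\ I 0, forall g h, I g -> I h -> I (g + h),
      forall g h, I h -> I (g * h)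
    & forall d g, I g -> I (homog_component d g)].

Definition point : set (set S) :=
  [set x | [/\ homogeneous_ideal x, ~ x 1,
               forall g h, x (g * h) -> x g \/ x h
             & exists i, ~ x 'X_i]].

Definition points_of I : set (set S) := [set x | point x /\ I `<=` x].

(* Let V be the closed subscheme defined by I and x a point of V.  The
   stalk O_{V,x} consists of the fractions a / s with a and s homogeneous of
   the same degree, s not in x, modulo I.  A homogeneous g gives an element
   of O_{V,x} up to a unit, on dividing by a power of some x_i not in x. *)

(* the g_i generate the ideal of O_{V,x} defined by J, where I and J are
   homogeneous ideals and J contains I *)
Definition generate_at I x J (d : nat) (g : 'I_d -> S) : Prop :=
  (forall i, is_homog (g i) /\ J (g i)) /\
  forall h, is_homog h -> J h ->
    exists2 s, is_homog s /\ ~ x s &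
      exists a : 'I_d -> S, I (s * h - \sum_(i < d) a i * g i).

(* smoothness of V at x by the Jacobian criterion: near x, the ideal of V is
   generated by d elements whose Jacobian matrix has rank d at x.  By Euler's
   relation the homogeneous Jacobian matrix has the same rank at a point of V
   as the Jacobian matrix in an affine chart. *)
Definition smooth_at I x : Prop :=
  exists (d : nat) (g : 'I_d -> S) (j : 'I_d -> 'I_n.+1),
    generate_at [set 0] x I g /\
    ~ x (\det (\matrix_(a < d, b < d) mderiv (j b) (g a))).

Definition smooth I : Prop := forall x, points_of I x -> smooth_at I x.

Definition projective_variety I : Prop := point I.

Definition chain Q x (d : nat) : Prop :=
  exists q : nat -> set S,
    [/\ q 0%N = Q, q d = x, forall i, (i <= d)%N -> point (q i)
      & forall i, (i < d)%N -> q i `<` q i.+1].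

(* d is the Krull dimension of the local ring at x of the integral closed
   subscheme with generic point Q *)
Definition local_dimension Q x (d : nat) : Prop :=
  chain Q x d /\ forall e, chain Q x e -> (e <= d)%N.

Definition regular_local_ring Q x : Prop :=
  exists d, local_dimension Q x d /\
    exists g : 'I_d -> S, generate_at Q x x g.

Definition regular Q : Prop :=
  forall x, points_of Q x -> regular_local_ring Q x.

(* the generic points of the irreducible components of the reduced
   subscheme underlying the one defined by I *)
Definition irreducible_component I : set (set S) :=
  [set Q | points_of I Q /\ forall x, points_of I x -> x `<=` Q -> x = Q].

(* g is a local equation at x of the closed subscheme defined by ID of the
   variety defined by IX; as O_{X,x} is a domain, nonzero elements are
   nonzerodivisors *)
Definition local_equation (IX ID : set S) x g : Prop :=
  ~ IX g /\ generate_at IX x ID (fun _ : 'I_1 => g).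

(* the empty divisor is allowed *)
Definition effective_cartier_divisor (IX ID : set S) : Prop :=
  [/\ homogeneous_ideal ID, IX `<=` ID
    & forall x, points_of IX x -> exists g, local_equation IX ID x g].

(* the open subscheme U = X \ D of X *)
Definition open_compl (IX ID : set S) : set (set S) :=
  points_of IX `\` points_of ID.

Definition closed_points (Y : set (set S)) : set (set S) :=
  [set x | Y x /\ forall y, Y y -> x `<=` y -> y = x].

Definition zero_cycles (Y : set (set S)) : zmodType :=
  {freeg (closed_points Y) / int}.

(* Normal curves over k.  An integral normal curve C over k is given by   *)
(* its function field K and the set of its closed points.  A closed point *)
(* is the normalized discrete valuation v : K -> Z u {+oo} of its local   *)
(* ring; we put v 0 = 0 instead of +oo, so that distinct functions are    *)
(* distinct points.  The normal projective model of K has all the         *)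
(* discrete valuations of K / k as closed points, and the curves with     *)
(* function field K are its nonempty open subschemes.                     *)

Section Curve.
Variables (K : fieldType) (iota : {rmorphism k -> K}).
Implicit Types (v : K -> int) (u f : K) (C : set (K -> int)).

(* finitely generated of transcendence degree one over k *)
Definition function_field1 : Prop :=
  exists t : K,
    (forall q : {poly k}, q != 0 -> (map_poly iota q).[t] != 0) /\
    exists (r : nat) (b : 'I_r -> K), forall u,
      exists (a : 'I_r -> {poly k}) (c : {poly k}),
        c != 0 /\
        u * (map_poly iota c).[t] = \sum_(i < r) (map_poly iota (a i)).[t] * b i.

Definition place : set (K -> int) :=
  [set v | [/\ v 0 = 0,
      forall u w, u != 0 -> w != 0 -> v (u * w) = v u + v w,
      forall u w, u != 0 -> w != 0 -> u + w != 0 ->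
        Num.min (v u) (v w) <= v (u + w),
      forall a, a != 0 -> v (iota a) = 0
    & exists u, v u = 1]].

(* v u >= m, with the convention v 0 = +oo *)
Definition val_ge v (m : int) u : Prop := u = 0 \/ m <= v u.

Definition normal_curve C : Prop :=
  C `<=` place /\ finite_set (place `\` C).

(* O(W) for an open subscheme W *)
Definition regular_functions (W : set (K -> int)) : set K :=
  [set u | forall v, W v -> val_ge v 0 u].

(* W -> Spec O(W) is an isomorphism *)
Definition affine (W : set (K -> int)) : Prop :=
  (forall u, exists a b,
     [/\ regular_functions W a, regular_functions W b, b != 0 & u = a / b]) /\
  forall v, place v -> (forall u, regular_functions W u -> val_ge v 0 u) -> W v.

(* A K-point of P^n with homogeneous coordinates F; a K-point of X extends
   uniquely to a morphism C -> X, as C is regular of dimension one and X is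
   proper.  Below phi denotes this morphism. *)
Variable F : 'I_n.+1 -> K.

Definition ev (G : 'I_n.+1 -> K) (g : S) : K := mmap iota G g.

Definition point_on I : Prop :=
  (exists i, F i != 0) /\ forall g, I g -> ev F g = 0.

(* homogeneous coordinates of the same K-point that define an
   O_v-point of P^n, where O_v is the valuation ring of v *)
Definition coordinates_at v (G : 'I_n.+1 -> K) : Prop :=
  [/\ exists2 c, c != 0 & forall i, G i = c * F i,
      forall i, val_ge v 0 (G i)
    & exists i, G i != 0 /\ v (G i) = 0].

(* the point phi(v) *)
Definition center v : set S :=
  [set g | exists2 G, coordinates_at v G &
     forall d, val_ge v 1 (ev G (homog_component d g))].

(* phi : C -> P^n is finite: the inverse image W of each standard affine open
   x_i != 0 is affine and O(W) is a finite module over k[x_0/x_i, ..., x_n/x_i].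
   If F i = 0 then W is the empty scheme. *)
Definition finite_morphism C : Prop :=
  forall i, F i != 0 ->
    let W := [set v | C v /\ ~ center v 'X_i] in
    affine W /\
    exists (r : nat) (b : 'I_r -> K),
      (forall l, regular_functions W (b l)) /\
      forall u, regular_functions W u ->
        exists a : 'I_r -> S,
          u = \sum_(l < r) ev (fun j => F j / F i) (a l) * b l.

(* the image in K of the local ring of P^n at phi(v); its residue field is
   that of phi(v) *)
Definition local_image v : set K :=
  [set u | exists a b d, [/\ homog_of d a, homog_of d b, ~ center v b
                           & u = ev F a / ev F b]].

(* d = [k(v) : k(phi(v))]: the residues of b_1, ..., b_d are a basis *)
Definition residue_basis v (d : nat) (b : 'I_d -> K) : Prop :=
  [/\ forall i, val_ge v 0 (b i),
      forall u, val_ge v 0 u -> exists2 c : 'I_d -> K,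
        (forall i, local_image v (c i)) &
        val_ge v 1 (u - \sum_(i < d) c i * b i)
    & forall c : 'I_d -> K, (forall i, local_image v (c i)) ->
        val_ge v 1 (\sum_(i < d) c i * b i) -> forall i, val_ge v 1 (c i)].

Definition residue_degree v : nat :=
  xget 0%N [set d | exists b : 'I_d -> K, residue_basis v b].

(* the multiplicity at x of phi_*(div f), for f != 0 and phi restricted to C;
   the sum is finite since f has finitely many zeros and poles *)
Definition push_div C f (x : set S) : int :=
  \sum_(v \in [set v | C v /\ center v = x]) (v f * (residue_degree v)%:Z).

(* Effective divisors on C are given by their multiplicities E v >= 0.
   An f in the group G(C, E) is a unit at the points of the support of E
   and is 1 modulo the ideal of E. *)
Definition G_group C (E : (K -> int) -> int) : set K :=
  [set f | f != 0 /\
     forall v, C v -> 0 < E v -> v f = 0 /\ val_ge v (E v) (f - 1)].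

(* E = phi^* D: the multiplicity at v is the valuation of the pullback of a
   local equation of D at phi(v) *)
Definition pullback_divisor (IX ID : set S) C (E : (K -> int) -> int) : Prop :=
  forall v, C v -> exists g G,
    [/\ local_equation IX ID (center v) g, coordinates_at v G & E v = v (ev G g)].

(* K is the function field of the integral closed subscheme with generic
   point Q, and F its generic point *)
Definition generic_point_of Q : Prop :=
  [/\ exists i, F i != 0,
      forall d g, homog_of d g -> (Q g <-> ev F g = 0)
    & forall u, exists d a b,
        [/\ homog_of d a, homog_of d b, ev F b != 0 & u = ev F a / ev F b]].

(* If F is the generic point of an integral closed curve in U, its
   normalization consists of the v whose center lies in U. *)
Definition normalization_over (U : set (set S)) : set (K -> int) :=
  [set v | place v /\ U (center v)].

(* the reduced divisor at infinity *)
Definition C_infty (U : set (set S)) v : int :=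
  if `[< normalization_over U v >] then 0 else 1.

End Curve.

Section Relations.
Variables IX ID : set S.
Let U := open_compl IX ID.

Definition modulus_relations : set (zero_cycles U) :=
  [set z | exists (K : fieldType) (iota : {rmorphism k -> K})
             (C : set (K -> int)) (F : 'I_n.+1 -> K)
             (E : (K -> int) -> int) (f : K),
    [/\ function_field1 iota /\ normal_curve iota C,
        point_on iota F IX /\ finite_morphism iota F C,
        (* phi(C) is not contained in D *)
        ~ point_on iota F ID,
        pullback_divisor iota F IX ID C E /\ G_group C E f
      & forall x : closed_points U, coeff x z = push_div iota F C f (val x)]].

Definition suslin_relations : set (zero_cycles U) :=
  [set z | exists (Q : set S) (K : fieldType) (iota : {rmorphism k -> K})
             (F : 'I_n.+1 -> K) (f : K),
    [/\ (* Q is the generic point of an integral closed curve in U *)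
        U Q, function_field1 iota, generic_point_of iota F Q,
        G_group (place iota) (C_infty iota F U) f
      & forall x : closed_points U,
          coeff x z = push_div iota F (normalization_over iota F U) f (val x)]].

Definition CH0_modulus : zmodType := span_quot modulus_relations.

Definition H0_suslin : zmodType := span_quot suslin_relations.

(* lambda_{X|D} is the homomorphism induced by the identity of Z_0(U); this
   determines it. *)
Definition induced_by_identity (lambda : CH0_modulus -> H0_suslin) : Prop :=
  forall z : zero_cycles U,
    lambda (span_proj modulus_relations z) = span_proj suslin_relations z.

End Relations.
End Projective.

(* Main.v *)
From HB Require Import structures.
Require Import Defs.
From mathcomp Require Import all_boot all_order all_algebra.
From mathcomp Require Import boolp classical_sets cardinality fsbigop.
From mathcomp Require Import finmap freeg mpoly fintype.
From mathcomp Require Import ring zify.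
Set Implicit Arguments.
Unset Strict Implicit.
Unset Printing Implicit Defensive.
Import Order.TTheory GRing.Theory Num.Theory.
Local Open Scope ring_scope.
Local Open Scope classical_set_scope.

(** Let [C] be the normalization of an integral closed curve in [U], with
    projective model [C'] and [phi : C' -> X], and let [f] be congruent to 1 at
    each point at infinity, that is to say modulo the reduced divisor of
    [phi^* D].  In characteristic [p], [f^(p^N) - 1 = (f - 1)^(p^N)] vanishes on
    [phi^* D] for [N] large, so [p^N div f] is a relation with modulus.  In
    characteristic 0, [f] has an approximate [m]-th root [h], a polynomial in
    [f - 1], such that [f / h^m] is 1 modulo [phi^* D]; as [h] is a unit at
    infinity, [div f] is a relation with modulus up to [m div h].  So the kernel
    of [lambda] is [p]-primary torsion, resp. contained in the multiples of [m].

    What this takes is that [phi] is finite on the curve of all places of the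
    function field and that a function has finitely many zeros.  Finiteness is
    obtained without integral closures: if [M] and [N] are the rings of functions
    regular where [t] is regular, resp. where [t] has a pole, then [N / t^-1 N]
    is finite dimensional over [k], and [M] and [t^-1 N] meet in 0. *)

(** * Linear dependence over k[x] *)

(** A place is a bare function [K -> int], so neither the existence of places nor the finiteness of
    zeros comes with the definitions. Both are drawn from one fact: for transcendental x there is an
    R such that any R + 1 elements of K are linearly dependent over k[x]. Dividing such a relation
    by a power of x makes the constant term of some coefficient nonzero, and that coefficient is
    then a unit wherever x vanishes. Comparing values in a normalized relation bounds three things:
    the length of chains in a valuation ring containing k, so that these rings are discrete; the
    number of zeros of x; and, for x = t^-1, the dimension of N / t^-1 N. The valuation rings
    themselves come from Zorn's lemma, as maximal subalgebras containing x but not x^-1. *)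

Lemma left_kernel (R : idomainType) n (A : 'I_n.+1 -> 'I_n -> R) :
  exists c : 'I_n.+1 -> R, (exists i, c i != 0) /\
    forall j, \sum_i c i * A i j = 0.
Proof.
elim: n A => [|n IHn] A.
  by exists (fun=> 1); split; [exists ord0; exact: oner_neq0 | case].
(* The pivot is a nonzero entry of the first column, or 1 if that column vanishes; one fraction-free
   elimination then covers both cases. *)
have [i0 [p [p0 hp]]] : exists i0 p, p != 0 /\
    ((forall i, A i ord0 = 0) \/ p = A i0 ord0).
  have [h|/existsNP [i /eqP hi]] := pselect (forall i, A i ord0 = 0).
    by exists ord0, 1; split; [exact: oner_neq0 | left].
  by exists i, (A i ord0); split=> //; right.
have [c [[i1 ci1] hc]] := IHn (fun (i : 'I_n.+1) (j : 'I_n) =>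
  p * A (lift i0 i) (lift ord0 j) - A (lift i0 i) ord0 * A i0 (lift ord0 j)).
exists (fun i => if unlift i0 i is Some i' then p * c i'
                 else - \sum_i c i * A (lift i0 i) ord0); split.
  by exists (lift i0 i1); rewrite /= liftK mulf_neq0.
move=> j; rewrite (bigD1_ord i0) //= unlift_none.
under [X in _ + X]eq_bigr => i _ do rewrite liftK.
rewrite mulNr mulr_suml -sumrN -big_split /=.
case: (unliftP ord0 j) => [j' ->|->].
  by rewrite -[RHS](hc j'); apply: eq_bigr => i _; ring.
case: hp => [h0|->]; apply: big1 => i _; first by rewrite !h0; ring.
by ring.
Qed.

Lemma divXpK (F : fieldType) (q : {poly F}) : q`_0 = 0 -> q = (q %/ 'X) * 'X.
Proof.
move=> h; apply/eqP; rewrite -Pdiv.Field.dvdp_eq -['X]subr0.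
by rewrite -[X in _ - X]/(0%:P) dvdp_XsubCl rootE horner_coef0 h.
Qed.

Section Dependence.
Variables (k K : fieldType) (iota : {rmorphism k -> K}).

Definition peval (x : K) (q : {poly k}) : K := (map_poly iota q).[x].

Lemma peval_is_zmod_morphism x : zmod_morphism (peval x).
Proof. by move=> p q; rewrite /peval rmorphB hornerD hornerN. Qed.

Lemma peval_is_monoid_morphism x : monoid_morphism (peval x).
Proof.
by split=> [|p q]; rewrite /peval ?rmorph1 ?hornerC // rmorphM hornerM.
Qed.

HB.instance Definition _ x :=
  GRing.isZmodMorphism.Build _ _ (peval x) (peval_is_zmod_morphism x).
HB.instance Definition _ x :=
  GRing.isMonoidMorphism.Build _ _ (peval x) (peval_is_monoid_morphism x).

Lemma pevalC x a : peval x a%:P = iota a.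
Proof. by rewrite /peval map_polyC hornerC. Qed.

Lemma pevalX x : peval x 'X = x.
Proof. by rewrite /peval map_polyX hornerX. Qed.

Lemma pevalE x q : peval x q = \sum_(i < size q) iota q`_i * x ^+ i.
Proof.
rewrite /peval (@horner_coef_wide _ (size q)) ?size_poly //.
by apply: eq_bigr => i _; rewrite coef_map.
Qed.

Definition transcendental (x : K) : Prop := forall q, q != 0 -> peval x q != 0.

Lemma transcendental_algebraicOver x :
  ~ algebraicOver iota x <-> transcendental x.
Proof.
split=> [h q q0|h [q q0 /eqP rq]]; last by move: (h q q0); rewrite /peval rq eqxx.
by apply/negP => rq; apply: h; exists q.
Qed.

Lemma transcendental_neq0 x : transcendental x -> x != 0.
Proof. by move=> /(_ 'X); rewrite pevalX polyX_eq0; apply. Qed.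

Lemma transcendentalV x : transcendental x -> transcendental x^-1.
Proof.
move=> /transcendental_algebraicOver h; apply/transcendental_algebraicOver => h'.
by apply: h; rewrite -[x]invrK; apply: algebraic_inv.
Qed.

(** For transcendental x this means [K : k(x)] <= R, without mention of the field k(x). *)
Definition bounded_dep (x : K) (R : nat) : Prop := forall u : 'I_R.+1 -> K,
  exists c : 'I_R.+1 -> {poly k}, (exists i, c i != 0) /\
    \sum_i peval x (c i) * u i = 0.

(** The span over the field k(x), with denominators cleared. *)
Definition frac_span (x : K) (I : finType) (b : I -> K) : set K :=
  [set y | exists a c, c != 0 /\
     y * peval x c = \sum_(i : I) peval x (a i) * b i].

Lemma frac_span_sum x (I : finType) (b : I -> K) (J : finType) (y : J -> K) :
  (forall j, frac_span x b (y j)) -> frac_span x b (\sum_j y j).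
Proof.
move=> hy; elim/big_ind : _ => //.
  exists (fun=> 0), 1; split; first exact: oner_neq0.
  by rewrite mul0r big1 // => i _; rewrite rmorph0 mul0r.
move=> u v [a [c [c0 hc]]] [a' [c' [c'0 hc']]].
exists (fun i => c' * a i + c * a' i), (c * c'); split; first exact: mulf_neq0.
have -> : (u + v) * peval x (c * c') =
    peval x c' * (u * peval x c) + peval x c * (v * peval x c').
  by rewrite rmorphM; ring.
rewrite hc hc' !mulr_sumr -big_split; apply: eq_bigr => i _ /=.
by rewrite rmorphD !rmorphM; ring.
Qed.

Lemma frac_span_bounded_dep x (I : finType) (b : I -> K) (u : 'I_(#|I|).+1 -> K) :
  transcendental x -> (forall i, frac_span x b (u i)) ->
  exists c : 'I_(#|I|).+1 -> {poly k}, (exists i, c i != 0) /\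
    \sum_i peval x (c i) * u i = 0.
Proof.
move=> tx /choice [a /choice [c hac]].
have [d [[i0 di0] hd]] := left_kernel (fun i j => a i (enum_val j)).
exists (fun i => d i * c i); split.
  by exists i0; rewrite mulf_neq0 //; case: (hac i0).
under eq_bigr => i _ do
  rewrite rmorphM -mulrA [peval x (c i) * _]mulrC (hac i).2 mulr_sumr.
rewrite exchange_big; apply: big1 => l _.
transitivity (peval x (\sum_i d i * a i l) * b l).
  rewrite rmorph_sum mulr_suml; apply: eq_bigr => i _.
  by rewrite rmorphM mulrA.
by have := hd (enum_rank l); rewrite enum_rankK => ->; rewrite rmorph0 mul0r.
Qed.

(* Division by a power of [X]. *)
Lemma bounded_dep_norm x R (u : 'I_R.+1 -> K) :
  transcendental x -> bounded_dep x R ->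
  exists c : 'I_R.+1 -> {poly k}, (exists i, (c i)`_0 != 0) /\
    \sum_i peval x (c i) * u i = 0.
Proof.
move=> tx /(_ u) [c [[i0 ci0] hc]].
have [N] : exists N, (\max_i size (c i) <= N)%N by exists (\max_i size (c i)).
elim: N c i0 ci0 hc => [|N IHN] c i0 ci0 hc hN.
  move: ci0; rewrite -size_poly_gt0 ltnNge.
  by rewrite (leq_trans (leq_bigmax (F := fun i => size (c i)) i0) hN).
have [h|/existsNP [i /eqP hi]] := pselect (forall i, (c i)`_0 = 0); last first.
  by exists c; split=> //; exists i.
have cE i : c i = (c i %/ 'X) * 'X by exact: divXpK.
apply: (IHN (fun i => c i %/ 'X) i0).
- by apply: contraNneq ci0 => h0; rewrite cE h0 mul0r.
- apply: (mulfI (transcendental_neq0 tx)); rewrite mulr0 -[RHS]hc mulr_sumr.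
  by apply: eq_bigr => i _; rewrite [in RHS]cE rmorphM /= pevalX; ring.
- apply/bigmax_leqP => i _.
  have := leq_trans (leq_bigmax (F := fun i => size (c i)) i) hN.
  by rewrite size_divp ?polyX_eq0 // size_polyX /=; move=> hh; rewrite leq_subLR add1n.
Qed.

(** Pseudo-division by the equation [m] of t over k[x] lowers the degree in t; the power of the
    leading coefficient that it introduces is the denominator. *)
Lemma peval_frac_span x t (m : {poly {poly k}}) (a : {poly k}) : m != 0 ->
  (map_poly (peval x) m).[t] = 0 ->
  frac_span x (fun l : 'I_(size m) => t ^+ l) (peval t a).
Proof.
move=> m0 hm; have := Pdiv.Idomain.divp_eq (map_poly polyC a) m.
set q := _ %/ _; set s := _ %% _ => e.
exists (fun l : 'I_(size m) => s`_l), (lead_coef m ^+ scalp (map_poly polyC a) m).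
split; first by rewrite expf_neq0 ?lead_coef_eq0.
have /(congr1 (fun p => (map_poly (peval x) p).[t])) := e.
rewrite rmorphD rmorphM hornerD hornerM hm mulr0 add0r.
rewrite map_polyZ hornerZ -map_poly_comp.
have -> : map_poly (peval x \o polyC) a = map_poly iota a.
  by apply: eq_map_poly => c; rewrite /= pevalC.
rewrite mulrC => ->; rewrite (@horner_coef_wide _ (size m)).
  by apply: eq_bigr => l _; rewrite coef_map.
by apply: leq_trans (size_poly _ _) _; rewrite ltnW // ltn_modp.
Qed.

(** K is finite over k(t), so the powers of x are dependent over k[t]. Read as an equation for t,
    this relation makes t algebraic over k(x), and the products t^l b_j span K over k(x). *)
Lemma function_field1_bounded_dep x :
  function_field1 iota -> transcendental x -> exists R, bounded_dep x R.
Proof.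
move=> [t [tt [r [b hb]]]] tx.
have tb u : frac_span t b u by [].
have [c [[i0 ci0] hc]] : exists c : 'I_(#|'I_r|).+1 -> {poly k},
    (exists i, c i != 0) /\ \sum_i peval t (c i) * x ^+ i = 0.
  exact: frac_span_bounded_dep (fun i => tb _).
(* the relation [sum c_i(t) x^i = 0], as a polynomial in [t] over [k[x]] *)
pose m : {poly {poly k}} := \sum_i map_poly polyC (c i) * ('X^i)%:P.
have m0 : (map_poly (peval x) m).[t] = 0.
  rewrite rmorph_sum horner_sum -[RHS]hc; apply: eq_bigr => i _.
  rewrite rmorphM hornerM /= map_polyC hornerC /= rmorphXn /= pevalX.
  rewrite -map_poly_comp; congr (_.[_] * _).
  by apply: eq_map_poly => a; rewrite /= pevalC.
have mn0 : m != 0.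
  have [j cij] : exists j, (c i0)`_j != 0.
    by exists (size (c i0)).-1; rewrite -lead_coefE lead_coef_eq0.
  apply: contraNneq cij => /(congr1 (fun p : {poly {poly k}} => p`_j`_i0)).
  rewrite !coef0 coef_sum coef_sum (bigD1 i0) //= coefMC coef_map /= coefCM.
  rewrite coefXn eqxx mulr1 big1 ?addr0 => [->//|i /negPf ii0].
  by rewrite coefMC coef_map /= coefCM coefXn eq_sym [_ == _]ii0 mulr0.
exists #|{: 'I_(size m) * 'I_r}| => u.
have /choice [a /choice [d had]] := fun i => tb (u i).
(* A common denominator of the u_i over k[t]; a relation between the w u_i can be divided by it. *)
pose w := \prod_i peval t (d i).
have w0 : w != 0.
  by apply/prodf_neq0 => i _; apply: tt; case: (had i).
have hs i : frac_span x (fun z : 'I_(size m) * 'I_r => t ^+ z.1 * b z.2) (w * u i).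
  pose wi := \prod_(l | l != i) d l.
  have -> : w * u i = \sum_j peval t (wi * a i j) * b j.
    rewrite /w (bigD1 i) //= mulrAC [_ * u i]mulrC (had i).2 mulr_suml.
    by apply: eq_bigr => j _; rewrite rmorphM rmorph_prod; ring.
  apply: frac_span_sum => j.
  have [a' [c' [c'0 hc']]] := peval_frac_span (wi * a i j) mn0 m0.
  exists (fun z => if z.2 == j then a' z.1 else 0), c'; split=> //.
  rewrite mulrAC hc' -(pair_bigA _ (fun l j' =>
    peval x (if j' == j then a' l else 0) * (t ^+ l * b j'))) /= mulr_suml.
  apply: eq_bigr => l _; rewrite (bigD1 j) //= eqxx big1 => [|j' /negPf ->].
    by rewrite addr0; ring.
  by rewrite rmorph0 mul0r.
have [f [nf hf]] := frac_span_bounded_dep tx hs.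
exists f; split=> //; apply: (mulfI w0); rewrite mulr0 -[RHS]hf mulr_sumr.
by apply: eq_bigr => i _; ring.
Qed.

End Dependence.

(** * Existence of places *)

Section Places.
Variables (k K : fieldType) (iota : {rmorphism k -> K}).
Local Notation peval := (peval iota).

Lemma transcendentalP (y : K) : y != 0 ->
  (forall q : {poly k}, q`_0 != 0 -> peval y q != 0) -> transcendental iota y.
Proof.
move=> y0 h q; have [N] : exists N, (size q <= N)%N by exists (size q).
elim: N q => [|N IHN] q hN q0; first by rewrite -size_poly_leq0 hN in q0.
have [h0|] := eqVneq q`_0 0; last exact: h.
have qE := divXpK h0.
rewrite qE rmorphM /= pevalX mulf_neq0 //; apply: IHN.
  by rewrite size_divp ?polyX_eq0 // size_polyX leq_subLR add1n.
by apply: contraNneq q0 => h1; rewrite qE h1 mul0r.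
Qed.

(** * Discreteness of the valuation rings of a function field *)

Section ValuationRing.
Variable R : set K.
Hypothesis R_iota : forall a, R (iota a).
Hypothesis R_sub : forall u v, R u -> R v -> R (u - v).
Hypothesis R_mul : forall u v, R u -> R v -> R (u * v).

Let R0 : R 0. Proof. by rewrite -(rmorph0 iota). Qed.
Let R1 : R 1. Proof. by rewrite -(rmorph1 iota). Qed.
Let R_opp u : R u -> R (- u). Proof. by rewrite -sub0r; exact: R_sub. Qed.
Let R_add u v : R u -> R v -> R (u + v).
Proof. by move=> Ru Rv; rewrite -[v]opprK; apply: R_sub => //; exact: R_opp. Qed.
Let R_exp u n : R u -> R (u ^+ n).
Proof. by move=> Ru; elim: n => // n IHn; rewrite exprS; exact: R_mul. Qed.
Let R_sum (I : finType) (P : pred I) (F : I -> K) :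
  (forall i, P i -> R (F i)) -> R (\sum_(i | P i) F i).
Proof. by move=> h; elim/big_ind : _. Qed.
Let R_peval y q : R y -> R (peval y q).
Proof.
move=> Ry; rewrite pevalE; apply: R_sum => i _.
by apply: R_mul; [exact: R_iota | exact: R_exp].
Qed.

Hypothesis R_val : forall z, R z \/ R z^-1.

(** The maximal ideal of [R]. Zero is listed apart because [0^-1 = 0] belongs to [R]. *)
Definition nonunit u := u = 0 \/ ~ R u^-1.

Lemma nonunit_R u : nonunit u -> R u.
Proof. by case=> [->//|h]; case: (R_val u). Qed.

Lemma nonunit_mul u v : nonunit u -> R v -> nonunit (u * v).
Proof.
case=> [->|hu Rv]; first by rewrite mul0r; left.
have [->|v0] := eqVneq v 0; first by rewrite mulr0; left.
right=> h; apply: hu; have -> : u^-1 = v * (u * v)^-1.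
  by rewrite invfM mulrCA divff ?mulr1.
exact: R_mul.
Qed.

Lemma nonunit_add u v : nonunit u -> nonunit v -> nonunit (u + v).
Proof.
wlog: u v / R (u / v).
  move=> W hu hv; have [h|h] := R_val (u / v); first exact: W.
  by rewrite addrC; apply: W => //; rewrite -[v / u]invrK invf_div.
move=> Ruv hu hv; have [v0|v0] := eqVneq v 0; first by rewrite v0 addr0.
have -> : u + v = v * (u / v + 1) by field.
by apply: nonunit_mul => //; exact: R_add.
Qed.

Lemma nonunit_opp u : nonunit u -> nonunit (- u).
Proof. by move=> h; rewrite -mulrN1; apply: nonunit_mul => //; exact: R_opp. Qed.

Lemma nonunit_sum (I : finType) (P : pred I) (F : I -> K) :
  (forall i, P i -> nonunit (F i)) -> nonunit (\sum_(i | P i) F i).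
Proof.
by move=> h; elim/big_ind : _ => //; [left | exact: nonunit_add].
Qed.

Lemma nonunit_iota a : nonunit (iota a) -> a = 0.
Proof.
case=> [/eqP|]; first by rewrite fmorph_eq0 => /eqP.
by rewrite -fmorphV => h; exfalso; exact: h.
Qed.

Lemma peval_sub_coef0 y q : exists r, peval y q - iota q`_0 = y * peval y r.
Proof.
exists ((q - (q`_0)%:P) %/ 'X).
have /divXpK : (q - (q`_0)%:P)`_0 = 0 by rewrite coefB coefC subrr.
move=> /(congr1 (peval y)).
by rewrite rmorphM /= pevalX rmorphB /= pevalC mulrC.
Qed.

Lemma nonunit_transcendental y : y != 0 -> nonunit y -> transcendental iota y.
Proof.
move=> y0 hy; apply: transcendentalP => // q; apply: contra_neq => h.
have [r] := peval_sub_coef0 y q; rewrite h sub0r => e.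
apply: nonunit_iota; rewrite -[iota _]opprK e; apply: nonunit_opp.
by apply: nonunit_mul => //; apply: R_peval; exact: nonunit_R.
Qed.

(** The c_i have strictly decreasing positive values, starting from that of y; in a discrete
    valuation ring a longest chain has length v(y). *)
Definition val_chain y n := exists c : nat -> K,
  [/\ c 0%N = y, forall i, (i < n)%N -> c i != 0 /\ nonunit (c i)
    & forall i, (i.+1 < n)%N -> nonunit (c i / c i.+1)].

(** In a normalized relation between c_0, ..., c_N over k[y], take the largest j with f_j(0) != 0.
    After division by c_j the j-th term is a unit and all others are nonunits: for i < j because c_i
    / c_j is one, for i > j because y divides f_i(y), y / c_j lies in [R] and c_i is a nonunit. *)
Lemma val_chain_bound y n N : y != 0 -> nonunit y ->
  bounded_dep iota y N -> val_chain y n -> (n <= N)%N.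
Proof.
move=> y0 hy bd [c [c0 hc hcS]]; rewrite leqNgt; apply/negP => ltNn.
have ty := nonunit_transcendental y0 hy.
have [f [[i0 fi0] hf]] := bounded_dep_norm (fun i => c i) ty bd.
have [j fj jmax] : exists2 j, (f j)`_0 != 0 &
    forall i, (f i)`_0 != 0 -> (i <= j)%N.
  by case: (arg_maxnP (P := fun i => (f i)`_0 != 0) val fi0) => j; exists j.
have lt_n i : (i < N.+1)%N -> (i < n)%N by move=> h; exact: leq_trans h ltNn.
have cj0 : c j != 0 by case: (hc j (lt_n _ (ltn_ord j))).
have ratio i d : (i + d.+1 < n)%N -> nonunit (c i / c (i + d.+1)%N).
  elim: d => [|d IHd]; first by rewrite addn1; exact: hcS.
  rewrite !addnS => h.
  have h' : (i + d.+1 < n)%N by rewrite addnS ltnW.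
  have [ci0 _] := hc _ h'.
  rewrite -[c i](divfK ci0) -[_ * _ * _ / _]mulrA; apply: nonunit_mul; first exact: IHd.
  by rewrite addnS; apply/nonunit_R/hcS.
have ratio_lt i i' : (i < i')%N -> (i' < n)%N -> nonunit (c i / c i').
  by move=> h; rewrite -(subnKC h) addSnnS; exact: ratio.
have yj : R (y / c j).
  rewrite -c0; have [->|j0] := posnP j; first by rewrite c0 divff.
  by apply/nonunit_R/ratio_lt => //; exact: lt_n.
have ryc i : peval y (f i) * c i / c j = peval y (f i) * (c i / c j).
  by rewrite mulrA.
have Ry := nonunit_R hy.
have : nonunit (peval y (f j)).
  have -> : peval y (f j) = - \sum_(i | i != j) peval y (f i) * c i / c j.
    rewrite -mulr_suml -mulNr; apply: (canRL (mulfK cj0)); apply/eqP.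
    by rewrite -addr_eq0 -[X in _ == X]hf [X in _ == X](bigD1 j).
  apply/nonunit_opp/nonunit_sum => i ij.
  have [hlt|hgt|/ord_inj e] := ltngtP i j; last by rewrite e eqxx in ij.
    rewrite ryc mulrC; apply: nonunit_mul; last exact: R_peval.
    by apply: ratio_lt => //; exact: lt_n.
  have fi : (f i)`_0 = 0.
    apply/eqP; apply: contraLR hgt => h; rewrite -leqNgt; exact: jmax.
  have [r] := peval_sub_coef0 y (f i); rewrite fi rmorph0 subr0 => ->.
  have -> : y * peval y r * c i / c j = c i * (peval y r * (y / c j)) by ring.
  apply: nonunit_mul; first by case: (hc i (lt_n _ (ltn_ord i))).
  by apply: R_mul => //; exact: R_peval.
have [r] := peval_sub_coef0 y (f j) => e.
move=> nfj; move/eqP: fj; apply; apply: nonunit_iota.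
have -> : iota (f j)`_0 = peval y (f j) - y * peval y r.
  by rewrite -e opprB addrC subrK.
by apply/nonunit_add/nonunit_opp/nonunit_mul => //; exact: R_peval.
Qed.

Hypothesis ff : function_field1 iota.
Variable x : K.
Hypothesis (x0 : x != 0) (hx : nonunit x).

(** The last element p of a longest chain from x works: a nonunit z with z / p outside [R] could be
    appended to the chain. *)
Lemma uniformizer : exists p, [/\ p != 0, nonunit p &
  forall z, nonunit z -> R (z / p)].
Proof.
have [N bd] := function_field1_bounded_dep ff (nonunit_transcendental x0 hx).
have ch1 : val_chain x 1.
  by exists (fun=> x); split=> // i; rewrite ltnS leqn0 => /eqP ->.
have exn : exists n, `[< val_chain x n >] by exists 1%N; apply/asboolP.
have bdn n : `[< val_chain x n >] -> (n <= N)%N.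
  by move/asboolP; exact: val_chain_bound.
case: (ex_maxnP exn bdn) => n /asboolP [c [c0 hc hcS]] nmax.
have n0 : (0 < n)%N by apply: nmax; apply/asboolP.
have [p0 hp] : c n.-1 != 0 /\ nonunit (c n.-1) by apply: hc; rewrite prednK.
exists (c n.-1); split=> // z hz; apply: contrapT => hR.
have z0 : z != 0 by apply: contra_notN hR => /eqP ->; rewrite mul0r.
have : (n.+1 <= n)%N; last by rewrite ltnn.
apply/nmax/asboolP; exists (fun i => if (i < n)%N then c i else z); split.
- by rewrite n0.
- by move=> i _; case: ifP => // lt_in; exact: hc.
- move=> i; rewrite ltnS => lt_in; rewrite lt_in; case: ifP => [|h]; first exact: hcS.
  have -> : i = n.-1 by lia.
  by right; rewrite invf_div.
Qed.

Lemma valuation_ring_place : exists v, place iota v /\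
  (forall z, val_ge v 0 z <-> R z).
Proof.
have [p [p0 hp pmax]] := uniformizer.
pose unit u := R u /\ R u^-1.
have punit_pos (m : nat) : (0 < m)%N -> ~ R (p ^+ m)^-1.
  case: m => // m _; have: nonunit (p ^+ m.+1).
    by rewrite exprS; apply: nonunit_mul => //; apply/R_exp/nonunit_R.
  by case=> [/eqP|//]; rewrite expf_eq0 (negPf p0) andbF.
have ex_pos z : z != 0 -> nonunit z -> exists m : nat, unit (z / p ^+ m).
  move=> z0 hz; apply: contrapT => /forallNP h.
  have hm m : nonunit (z / p ^+ m).
    elim: m => [|m IHm]; first by rewrite expr0 divr1.
    have := pmax _ IHm; rewrite -mulrA -invfM -exprSr => hR.
    by right=> hR'; apply: (h m.+1).
  have [N bd] := function_field1_bounded_dep ff (nonunit_transcendental z0 hz).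
  suff : (N.+1 <= N)%N by rewrite ltnn.
  apply: (val_chain_bound z0 hz bd).
  (* If no z / p^m is a unit, then z, p^N, ..., p is a chain of the forbidden length N + 1. *)
  exists (fun i => if i == 0%N then z else p ^+ (N.+1 - i)); split=> //.
    move=> [//|i] hi /=; split; first by rewrite expf_neq0.
    rewrite subSS; have -> : (N - i = (N - i).-1.+1)%N by lia.
    by rewrite exprS; apply: nonunit_mul => //; apply/R_exp/nonunit_R.
  move=> [|i] hi; rewrite ?eqxx /=; first exact: hm.
  have -> : (N.+1 - i.+1 = (N.+1 - i.+2).+1)%N by lia.
  by rewrite exprS mulfK // expf_neq0.
have ex z : z != 0 -> exists m : int, unit (z * p ^ (- m)).
  move=> z0; have [hz|hz] := pselect (nonunit z).
    by have [m hm] := ex_pos z z0 hz; exists m%:Z; rewrite -exprnN.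
  have [hz'|hz'] := pselect (nonunit z^-1).
    have [m [h1 h2]] := ex_pos _ (invr_neq0 z0) hz'.
    exists (- m%:Z); rewrite opprK; split; last by rewrite invfM.
    by move: h2; rewrite invfM !invrK.
  exists 0; rewrite oppr0 expr0z mulr1; split; apply: contrapT => h.
    by apply: hz'; right; rewrite invrK.
  by apply: hz; right.
pose v z := if z == 0 then 0 else xget 0 [set m : int | unit (z * p ^ (- m))].
have vP z : z != 0 -> unit (z * p ^ (- v z)).
  move=> z0; rewrite /v (negPf z0); case: xgetP => [_ -> //|h].
  by case: (ex z z0) => m /h.
have v_ge z m : z != 0 -> (m <= v z <-> R (z * p ^ (- m))).
  move=> z0; have [h1 h2] := vP z z0; split=> [le|hR].
    have -> : z * p ^ (- m) = z * p ^ (- v z) * p ^+ `|v z - m|%N.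
      rewrite -mulrA exprnP -expfzDr //; congr (_ * p ^ _).
      by rewrite gez0_abs ?subr_ge0 // addKr.
    by apply/R_mul/R_exp/nonunit_R.
  rewrite leNgt; apply/negP => lt; apply: (punit_pos `|m - v z|%N).
    by rewrite absz_gt0 subr_eq0 gt_eqF.
  have -> : (p ^+ `|m - v z|%N)^-1 = z * p ^ (- m) * (z * p ^ (- v z))^-1.
    rewrite exprnN gez0_abs ?subr_ge0 ?ltW // invfM mulrACA divff // mul1r.
    by rewrite invr_expz opprK opprB expfzDr // mulrC.
  exact: R_mul.
have uniq z m : z != 0 -> unit (z * p ^ (- m)) -> v z = m.
  move=> z0 [h1 h2]; apply/eqP; rewrite eq_le; apply/andP; split; last exact/v_ge.
  have w0 : z^-1 != 0 by rewrite invr_eq0.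
  rewrite leNgt; apply/negP => lt; apply: (punit_pos `|v z - m|%N).
    by rewrite absz_gt0 subr_eq0 gt_eqF.
  have -> : (p ^+ `|v z - m|%N)^-1 = z * p ^ (- v z) * (z * p ^ (- m))^-1.
    rewrite exprnN gez0_abs ?subr_ge0 ?ltW // invfM mulrACA divff // mul1r.
    by rewrite invr_expz opprK opprB expfzDr // mulrC.
  by apply: R_mul => //; case: (vP z z0).
exists v; split.
  split.
  - by rewrite /v eqxx.
  - move=> u w u0 w0; apply: uniq; first exact: mulf_neq0.
    have [a1 a2] := vP u u0; have [b1 b2] := vP w w0.
    rewrite opprD expfzDr // mulrACA; split; first exact: R_mul.
    by rewrite invfM; exact: R_mul.
  - move=> u w u0 w0 uw0; apply/v_ge => //; rewrite mulrDl.
    by apply: R_add; apply/v_ge => //; rewrite ge_min lexx ?orbT.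
  - move=> a a0; apply: uniq; first by rewrite fmorph_eq0.
    by rewrite oppr0 expr0z mulr1; split; rewrite -?fmorphV; exact: R_iota.
  - by exists p; apply: uniq => //; rewrite exprN1 divff //; split; rewrite ?invr1.
move=> z; split=> [[->//|]|hz].
  have [->//|z0] := eqVneq z 0; move/v_ge => /(_ z0).
  by rewrite oppr0 expr0z mulr1.
have [->|z0] := eqVneq z 0; [by left | right].
by apply/v_ge => //; rewrite oppr0 expr0z mulr1.
Qed.

End ValuationRing.
End Places.

(** * Chevalley's construction of a valuation ring with a prescribed nonunit *)

Section PlaceExists.
Variables (k K : fieldType) (iota : {rmorphism k -> K}).
Local Notation peval := (peval iota).

Definition subalgebra (R : set K) : Prop :=
  [/\ forall a, R (iota a), forall u v, R u -> R v -> R (u - v)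
    & forall u v, R u -> R v -> R (u * v)].

Definition admissible (x : K) (R : set K) : Prop :=
  [/\ subalgebra R, R x & ~ R x^-1].

Section Maximal.
Variables (x : K) (R : set K).
Hypothesis adR : admissible x R.
Hypothesis maxR : forall A, R `<=` A -> admissible x A -> A `<=` R.

Let R_iota a : R (iota a). Proof. by case: adR => -[]. Qed.
Let R_sub u v : R u -> R v -> R (u - v).
Proof. by case: adR => -[_ h _] _ _; exact: h. Qed.
Let R_mul u v : R u -> R v -> R (u * v).
Proof. by case: adR => -[_ _ h] _ _; exact: h. Qed.
Let Rx : R x. Proof. by case: adR. Qed.
Let RxV : ~ R x^-1. Proof. by case: adR. Qed.
Let R0 : R 0. Proof. by rewrite -(rmorph0 iota). Qed.
Let R1 : R 1. Proof. by rewrite -(rmorph1 iota). Qed.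
Let R_opp u : R u -> R (- u). Proof. by rewrite -sub0r; exact: R_sub. Qed.
Let R_add u v : R u -> R v -> R (u + v).
Proof. by move=> Ru Rv; rewrite -[v]opprK; apply: R_sub => //; exact: R_opp. Qed.
Let R_exp u n : R u -> R (u ^+ n).
Proof. by move=> Ru; elim: n => // n IHn; rewrite exprS; exact: R_mul. Qed.
Let x_neq0 : x != 0.
Proof. by apply: contra_notN RxV => /eqP ->; rewrite invr0. Qed.

(** Inverting d = 1 - x a keeps the algebra admissible: since d^n = 1 - x b, having x^-1 d^n in [R]
    would put x^-1 in [R]. Maximality does the rest. *)
Lemma maximal_unit a : R a -> R (1 - x * a)^-1.
Proof.
move=> Ra; set d := 1 - x * a.
have d0 : d != 0.
  apply: contra_notN RxV; rewrite subr_eq0 => /eqP e.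
  by rewrite -[x^-1]mulr1 e mulKf.
have Rd : R d by apply: R_sub => //; exact: R_mul.
have dn n : exists2 b, R b & d ^+ n = 1 - x * b.
  elim: n => [|n [b Rb e]]; first by exists 0; rewrite // mulr0 subr0.
  exists (a + b - x * a * b); last by rewrite exprS e /d; ring.
  by apply: R_sub; [exact: R_add | apply: R_mul => //; exact: R_mul].
pose A := [set u | exists n, R (u * d ^+ n)].
have RA : R `<=` A by move=> u Ru; exists 0%N; rewrite mulr1.
apply: (maxR RA); last by exists 1%N; rewrite expr1 mulVf.
split; last 1 first.
- move=> [n hn]; apply: RxV; have [b Rb e] := dn n.
  have -> : x^-1 = x^-1 * d ^+ n + b by rewrite e mulrBr mulr1 mulKf // subrK.
  exact: R_add.
- split=> [a'|u v [n hn] [m hm]|u v [n hn] [m hm]]; first exact/RA.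
    exists (n + m)%N; rewrite exprD.
    have -> : (u - v) * (d ^+ n * d ^+ m) =
      u * d ^+ n * d ^+ m - v * d ^+ m * d ^+ n by ring.
    by apply: R_sub; apply: R_mul => //; exact: R_exp.
  by exists (n + m)%N; rewrite exprD mulrACA; exact: R_mul.
- exact: RA.
Qed.

(** This expresses x^-1 as a polynomial in z over [R] of degree at most n, which is the obstruction
    to adjoining z to [R]. *)
Definition x_relation (n : nat) (z : K) : Prop := exists a : nat -> K,
  (forall i, R (a i)) /\ \sum_(i < n.+1) x * a i * z ^+ i = 1.

Lemma x_relation0 z : ~ x_relation 0 z.
Proof.
move=> [a [Ra]]; rewrite big_ord1 expr0 mulr1 => e; apply: RxV.
by rewrite -[x^-1]mulr1 -e mulKf.
Qed.

Lemma x_relation_le n m z : (n <= m)%N -> x_relation n z -> x_relation m z.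
Proof.
move=> le [a [Ra e]]; exists (fun i => if (i < n.+1)%N then a i else 0); split.
  by move=> i; case: ifP.
rewrite -[RHS]e (big_ord_widen m.+1 (fun i => x * a i * z ^+ i)) //.
rewrite [RHS]big_mkcond /=; apply: eq_bigr => i _.
by case: ifP => //; rewrite mulr0 mul0r.
Qed.

(* Chevalley: eliminate the top term by means of the relation for [z^-1]. *)
Lemma x_relation_pred n z : z != 0 ->
  x_relation n.+1 z -> x_relation n.+1 z^-1 -> x_relation n z.
Proof.
move=> z0 [a [Ra ea]] [b [Rb eb]].
have Re := maximal_unit (Rb 0%N); set e := (_ - _)^-1 in Re.
have d0 : 1 - x * b 0%N != 0.
  apply: contra_notN RxV; rewrite subr_eq0 => /eqP e'.
  by rewrite -[x^-1]mulr1 e' mulKf.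
(* The relation for z^-1, multiplied by z^(n+1), has top term x b_0 z^(n+1); moving it to the other
   side leaves the unit 1 - x b_0 as coefficient of z^(n+1). *)
have hz : z ^+ n.+1 = \sum_(i < n.+1) x * (e * b (n.+1 - i)%N) * z ^+ i.
  have -> : z ^+ n.+1 = e * (1 - x * b 0%N) * z ^+ n.+1 by rewrite mulVf ?mul1r.
  rewrite -{1}eb big_ord_recl expr0 mulr1 addrAC subrr add0r.
  rewrite mulr_sumr mulr_suml (reindex_inj rev_ord_inj) /=.
  apply: eq_bigr => i _; have li := ltn_ord i.
  have -> : bump 0 (n.+1 - i.+1) = (n.+1 - i)%N by rewrite /bump /=; lia.
  have -> : z ^+ n.+1 = z ^+ (n.+1 - i) * z ^+ i by rewrite -exprD subnK // ltnW.
  rewrite exprVn; field; rewrite expf_neq0 //.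
exists (fun i => a i + x * a n.+1 * (e * b (n.+1 - i)%N)); split.
  by move=> i; apply: R_add => //; apply: R_mul; apply: R_mul.
rewrite -[RHS]ea [RHS]big_ord_recr /= hz mulr_sumr -big_split; apply: eq_bigr => i _ /=.
by ring.
Qed.

(** If z and z^-1 are both outside [R], adjoining either one makes x invertible. The two relations
    are brought to a common degree and then shorten each other down to degree 0, where x would be a
    unit of [R]. *)
Lemma maximal_valuation z : R z \/ R z^-1.
Proof.
have [->|z0] := eqVneq z 0; first by left.
have rel y : y != 0 -> ~ R y -> exists n, x_relation n y.
  move=> y0 hy; apply: contrapT => /forallNP nrel.
  pose A := [set u | exists n (a : nat -> K), (forall i, R (a i)) /\
    u = \sum_(i < n) a i * y ^+ i].
  have RA : R `<=` A.
    by move=> u Ru; exists 1%N, (fun=> u); rewrite big_ord1 mulr1.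
  have wide n m (a : nat -> K) : (forall i, R (a i)) -> (n <= m)%N -> exists b : nat -> K,
      (forall i, R (b i)) /\ \sum_(i < n) a i * y ^+ i = \sum_(i < m) b i * y ^+ i.
    move=> Ra le; exists (fun i => if (i < n)%N then a i else 0); split.
      by move=> i; case: ifP.
    rewrite (big_ord_widen m (fun i => a i * y ^+ i)) // big_mkcond /=.
    by apply: eq_bigr => i _; case: ifP => //; rewrite mul0r.
  have Asub u v : A u -> A v -> A (u - v).
    move=> [n [a [Ra ->]]] [m [b [Rb ->]]].
    have [a' [Ra' ->]] := wide _ _ _ Ra (leq_addr m n).
    have [b' [Rb' ->]] := wide _ _ _ Rb (leq_addl n m).
    exists (n + m)%N, (fun i => a' i - b' i); split; first by move=> i; exact: R_sub.
    by rewrite -sumrB; apply: eq_bigr => i _; rewrite mulrBl.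
  have A0 : A 0 by exact: RA.
  have Aadd u v : A u -> A v -> A (u + v).
    by move=> Au Av; rewrite -[v]opprK; apply: (Asub) => //; rewrite -sub0r; exact: Asub.
  have Amon c i : R c -> A (c * y ^+ i).
    move=> Rc; exists i.+1, (fun j => if j == i then c else 0); split.
      by move=> j; case: ifP.
    rewrite big_ord_recr /= eqxx big1 ?add0r // => j _.
    by rewrite ltn_eqF // mul0r.
  apply: hy; apply: (maxR RA); last by have := Amon 1 1%N R1; rewrite mul1r.
  split.
  - split=> [a|//|u v [n [a [Ra ->]]] [m [b [Rb ->]]]]; first exact: RA.
    rewrite mulr_suml; elim/big_ind : _ => // i _.
    rewrite mulr_sumr; elim/big_ind : _ => // j _.
    by rewrite mulrACA -exprD; apply: Amon; exact: R_mul.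
  - exact: RA.
  (* A sum with n terms is a relation of degree n - 1; n = 0 is excluded since it would give x^-1 =
     0. *)
  - move=> [n [a [Ra e]]]; apply: (nrel n.-1).
    exists a; split=> //.
    have -> : n.-1.+1 = n.
      case: n e => // e; move/eqP: e; rewrite big_ord0 invr_eq0.
      by rewrite (negPf x_neq0).
    under eq_bigr => i _ do rewrite -mulrA.
    by rewrite -mulr_sumr -e divff.
apply: contrapT => /not_orP [h1 h2].
have [n hn] := rel _ z0 h1; have [m hm] := rel _ (invr_neq0 z0) h2.
have := x_relation_le (leq_addl n m) hm; have := x_relation_le (leq_addr m n) hn.
move: (n + m)%N => {hn hm}; elim=> [/x_relation0//|l IHl] r1 r2.
apply: IHl; first exact: x_relation_pred.
by apply: x_relation_pred; rewrite ?invr_eq0 ?invrK.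
Qed.

End Maximal.

Lemma exists_maximal x : transcendental iota x -> exists R, admissible x R /\
  forall A, R `<=` A -> admissible x A -> A `<=` R.
Proof.
move=> tx; have x0 := transcendental_neq0 tx.
have adx : admissible x [set u | exists q, u = peval x q].
  split; last 1 first.
  - move=> [q e]; have : 'X * q - 1 != 0.
      apply/negP; rewrite subr_eq0 => /eqP/(congr1 (fun r : {poly k} => r`_0)).
      by rewrite coefXM coef1 => /esym/eqP; rewrite oner_eq0.
    by move/tx; rewrite rmorphB rmorphM rmorph1 /= pevalX -e divff // subrr eqxx.
  - split=> [a|u v [p ->] [q ->]|u v [p ->] [q ->]].
    + by exists a%:P; rewrite pevalC.
    + by exists (p - q); rewrite rmorphB.
    + by exists (p * q); rewrite rmorphM.
  - by exists 'X; rewrite pevalX.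
have [R [adR maxR]] : exists A, (A = set0 \/ admissible x A) /\
    forall B, A `<` B -> ~ (B = set0 \/ admissible x B).
  apply: (Zorn_bigcup (P := [set A | A = set0 \/ admissible x A])) => F FP tot.
  have [[A0 [FA0 [u0 Au0]]]|h] := pselect (exists A, F A /\ A !=set0); last first.
    left; apply/seteqP; split=> // u [A FA Au]; exfalso; apply: h; exists A; split=> //.
    by exists u.
  right.
  have ad A u : F A -> A u -> admissible x A.
    by move=> FA Au; case: (FP A FA) => // e; rewrite e in Au.
  have two A B u v : F A -> F B -> A u -> B v ->
      exists C, [/\ F C, admissible x C, C u & C v].
    move=> FA FB Au Bv; have [AB|BA] := tot A B FA FB.
      by exists B; split=> //; [exact: ad Bv | exact: AB].
    by exists A; split=> //; [exact: ad Au | exact: BA].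
  have [[i0 s0 m0] xA0 _] := ad _ _ FA0 Au0.
  split; last 1 first.
  - by move=> [A FA] AxV; have [_ _] := ad _ _ FA AxV.
  - split=> [a|u v [A FA Au] [B FB Bv]|u v [A FA Au] [B FB Bv]].
    + by exists A0.
    + have [C [FC [[_ h _] _ _] Cu Cv]] := two _ _ _ _ FA FB Au Bv.
      by exists C => //; exact: h.
    + have [C [FC [[_ _ h] _ _] Cu Cv]] := two _ _ _ _ FA FB Au Bv.
      by exists C => //; exact: h.
  - by exists A0.
have adR' : admissible x R.
  case: adR => // R0; exfalso.
  apply: (maxR [set u | exists q, u = peval x q]); last by right.
  by rewrite R0; split=> // /(_ x) []; exists 'X; rewrite pevalX.
exists R; split=> // A RA adA; apply: contrapT => nAR.
by apply: (maxR A); [split | right].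
Qed.

Lemma exists_place x : function_field1 iota -> transcendental iota x ->
  exists v, place iota v /\ 0 < v x.
Proof.
move=> ff tx; have x0 := transcendental_neq0 tx.
have [R [adR maxR]] := exists_maximal tx.
have [[Ri Rs Rm] Rx RxV] := adR.
have Rval := maximal_valuation adR maxR.
have nx : nonunit R x by right.
have [v [pv hv]] := valuation_ring_place Ri Rs Rm Rval ff x0 nx.
exists v; split=> //; rewrite ltNge; apply/negP => le.
apply: RxV; apply/hv; right; have [_ vM _ viota _] := pv.
have : v (x * x^-1) = 0.
  by rewrite divff // -(rmorph1 iota); apply: viota; exact: oner_neq0.
by rewrite vM ?invr_eq0 //; lia.
Qed.

End PlaceExists.

(** * Approximation and finiteness of zeros *)

Section PlaceTheory.
Variables (k K : fieldType) (iota : {rmorphism k -> K}).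
Local Notation peval := (peval iota).

Section OnePlace.
Variable v : K -> int.
Hypothesis pv : place iota v.

Lemma place0 : v 0 = 0. Proof. by case: pv. Qed.

Lemma placeM u w : u != 0 -> w != 0 -> v (u * w) = v u + v w.
Proof. by case: pv => _ h _ _ _; exact: h. Qed.

Lemma place_iota a : v (iota a) = 0.
Proof.
have [->|a0] := eqVneq a 0; first by rewrite rmorph0 place0.
by case: pv => _ _ _ h _; exact: h.
Qed.

Lemma place1 : v 1 = 0. Proof. by rewrite -(rmorph1 iota) place_iota. Qed.

Lemma placeN u : v (- u) = v u.
Proof.
have [->|u0] := eqVneq u 0; first by rewrite oppr0.
rewrite -mulN1r placeM ?oppr_eq0 ?oner_neq0 //.
by rewrite -(rmorph1 iota) -rmorphN place_iota add0r.
Qed.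

Lemma placeV u : v u^-1 = - v u.
Proof.
have [->|u0] := eqVneq u 0; first by rewrite invr0 place0.
by apply/eqP; rewrite -addr_eq0 -placeM ?invr_eq0 // mulVf // place1.
Qed.

Lemma placeX u n : v (u ^+ n) = v u *+ n.
Proof.
have [->|u0] := eqVneq u 0.
  by rewrite expr0n place0 mul0rn; case: eqP => _; rewrite ?place1 ?place0.
elim: n => [|n IHn]; first by rewrite expr0 place1.
by rewrite exprS placeM ?expf_neq0 // IHn mulrS.
Qed.

Lemma placeXz u (m : int) : v (u ^ m) = v u * m.
Proof.
case: m => n; first by rewrite -exprnP placeX -mulr_natr natz.
by rewrite NegzE -exprnN placeV placeX -mulr_natr natz mulrN.
Qed.

Lemma val_ge0 m : val_ge v m 0. Proof. by left. Qed.

Lemma val_ge_le m m' u : m <= m' -> val_ge v m' u -> val_ge v m u.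
Proof. by move=> le [->|h]; [left | right; exact: le_trans h]. Qed.

Lemma val_geN m u : val_ge v m u -> val_ge v m (- u).
Proof. by case=> [->|h]; [left; rewrite oppr0 | right; rewrite placeN]. Qed.

Lemma val_geD m u w : val_ge v m u -> val_ge v m w -> val_ge v m (u + w).
Proof.
have [->|u0] := eqVneq u 0; first by rewrite add0r.
have [->|w0] := eqVneq w 0; first by rewrite addr0.
case=> [/eqP|hu]; first by rewrite (negPf u0).
case=> [/eqP|hw]; first by rewrite (negPf w0).
have [->|uw0] := eqVneq (u + w) 0; [by left | right].
case: pv => _ _ h _ _; apply: le_trans (h u w u0 w0 uw0).
by rewrite le_min hu hw.
Qed.

Lemma val_geB m u w : val_ge v m u -> val_ge v m w -> val_ge v m (u - w).
Proof. by move=> hu hw; apply: val_geD => //; exact: val_geN. Qed.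

Lemma val_ge_sum m (I : Type) (s : seq I) (P : pred I) (F : I -> K) :
  (forall i, P i -> val_ge v m (F i)) -> val_ge v m (\sum_(i <- s | P i) F i).
Proof.
by move=> h; elim/big_ind : _ => //; [exact: val_ge0 | exact: val_geD].
Qed.

Lemma val_geM m m' u w :
  val_ge v m u -> val_ge v m' w -> val_ge v (m + m') (u * w).
Proof.
have [->|u0] := eqVneq u 0; first by rewrite mul0r; left.
have [->|w0] := eqVneq w 0; first by rewrite mulr0; left.
case=> [/eqP|hu]; first by rewrite (negPf u0).
case=> [/eqP|hw]; first by rewrite (negPf w0).
by right; rewrite placeM // lerD.
Qed.

Lemma val_geMl m u w : val_ge v 0 u -> val_ge v m w -> val_ge v m (u * w).
Proof. by move=> hu hw; rewrite -[m]add0r; exact: val_geM. Qed.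

Lemma val_geMr m u w : val_ge v m u -> val_ge v 0 w -> val_ge v m (u * w).
Proof. by move=> hu hw; rewrite mulrC; exact: val_geMl. Qed.

Lemma val_ge_iota a : val_ge v 0 (iota a).
Proof. by right; rewrite place_iota. Qed.

Lemma val_ge1 : val_ge v 0 1.
Proof. by right; rewrite place1. Qed.

Lemma val_geX u n : val_ge v 0 u -> val_ge v 0 (u ^+ n).
Proof.
move=> hu; elim: n => [|n IHn]; first by rewrite expr0; exact: val_ge1.
by rewrite exprS; exact: val_geMl.
Qed.

Lemma val_ge_expn m u n : val_ge v m u -> (0 < n)%N -> val_ge v (m *+ n) (u ^+ n).
Proof.
move=> hu; elim: n => // -[_ _|n IHn _]; first by rewrite mulr1n expr1.
by rewrite exprS mulrS; apply: val_geM => //; exact: IHn.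
Qed.

Lemma val_ge_peval x q : val_ge v 0 x -> val_ge v 0 (peval x q).
Proof.
move=> hx; rewrite pevalE; apply: val_ge_sum => i _.
by apply: val_geMl; [exact: val_ge_iota | exact: val_geX].
Qed.

Lemma val_ge_not m u : u != 0 -> v u < m -> ~ val_ge v m u.
Proof.
move=> u0 lt [/eqP|]; first by rewrite (negPf u0).
by rewrite leNgt lt.
Qed.

Lemma place_addl u w : u != 0 -> val_ge v (v u + 1) w ->
  u + w != 0 /\ v (u + w) = v u.
Proof.
move=> u0 hw; have nu : ~ val_ge v (v u + 1) u.
  by apply: val_ge_not => //; rewrite ltrDl.
have n0 : u + w != 0.
  apply: contra_notN nu; rewrite addr_eq0 => /eqP e.
  by rewrite [X in val_ge _ _ X]e; exact: val_geN.
split=> //; apply/eqP; rewrite eq_le; apply/andP; split.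
  rewrite leNgt; apply/negP => lt; apply: nu.
  rewrite -[X in val_ge _ _ X](addrK w).
  by apply: val_geB => //; right; rewrite lezD1.
have [/eqP|//] : val_ge v (v u) (u + w); last by rewrite (negPf n0).
apply: val_geD; first by right.
by apply: val_ge_le hw; rewrite lerDl.
Qed.

Lemma place_peval x (q : {poly k}) : val_ge v 1 x -> q`_0 != 0 ->
  peval x q != 0 /\ v (peval x q) = 0.
Proof.
move=> hx q0; have [r e] := peval_sub_coef0 iota x q.
have -> : peval x q = iota q`_0 + x * peval x r by rewrite -e addrC subrK.
rewrite -[X in _ /\ _ = X](place_iota q`_0); apply: place_addl.
  by rewrite fmorph_eq0.
rewrite place_iota; apply: val_geMr => //; apply: val_ge_peval.
exact: val_ge_le hx.
Qed.

Lemma place_transcendental x : v x != 0 -> transcendental iota x.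
Proof.
wlog: x / 0 < v x.
  move=> W vx; have [lt|le] := ltP 0 (v x); first exact: W.
  rewrite -[x]invrK; apply: transcendentalV; apply: W; rewrite placeV ?oppr_eq0 //.
  by rewrite oppr_gt0 lt_neqAle vx.
move=> lt vx; apply: transcendentalP.
  by apply: contraNneq vx => ->; rewrite place0.
move=> q q0; suff [] : peval x q != 0 /\ v (peval x q) = 0 by [].
by apply: place_peval => //; right; rewrite -gtz0_ge1.
Qed.

End OnePlace.

(** If the valuation ring of v lay in that of w, units for v would be units for w, so that w = w(p)
    v for a uniformizer p of v; as w takes the value 1, w(p) = 1 and the places coincide. *)
Lemma place_separate v w : place iota v -> place iota w -> v <> w ->
  exists2 u, u != 0 & 0 <= v u /\ w u < 0.
Proof.
move=> pv pw nvw; apply: contrapT => h.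
have sub u : u != 0 -> 0 <= v u -> 0 <= w u.
  by move=> u0 hu; rewrite leNgt; apply/negP => hw; apply: h; exists u.
have sub0 u : v u = 0 -> w u = 0.
  move=> vu; have [->|u0] := eqVneq u 0; first exact: (place0 pw).
  apply/eqP; rewrite eq_le sub ?vu // andbT -oppr_ge0 -(placeV pw).
  by apply: sub; rewrite ?invr_eq0 // (placeV pv) vu oppr0.
have [_ _ _ _ [p vp]] := pv; have [_ _ _ _ [p' wp']] := pw.
have p0 : p != 0.
  by apply/eqP => e; move: vp; rewrite e (place0 pv).
have key u : u != 0 -> w u = w p * v u.
  move=> u0; have : w (u * p ^ (- v u)) = 0.
    by apply: sub0; rewrite (placeM pv) ?expfz_neq0 // (placeXz pv) vp mul1r subrr.
  rewrite (placeM pw) ?expfz_neq0 // (placeXz pw) mulrN.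
  by move/eqP; rewrite subr_eq0 => /eqP.
have p'0 : p' != 0.
  by apply/eqP => e; move: wp'; rewrite e (place0 pw).
have wp : w p = 1.
  have := key p' p'0; rewrite wp'.
  have : 0 <= w p by apply: sub; rewrite ?vp.
  by case: (w p) (v p') => [[|[|n]]|n] [[|[|m]]|m] // _; nia.
apply: nvw; apply/funext => u; have [->|u0] := eqVneq u 0.
  by rewrite (place0 pv) (place0 pw).
by rewrite key // wp mul1r.
Qed.

Lemma place_approx v (s : seq (K -> int)) : place iota v ->
  (forall w, w \in s -> place iota w) -> v \notin s ->
  exists2 e, e != 0 & 0 < v e /\ forall w, w \in s -> w e < 0.
Proof.
move=> pv; elim: s => [|w s IHs] ps vs.
  have [_ _ _ _ [p vp]] := pv; exists p; last by rewrite vp.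
  by apply/eqP => e; move: vp; rewrite e (place0 pv).
have pw : place iota w by apply: ps; rewrite inE eqxx.
have [nvw nvs] : v <> w /\ v \notin s.
  by move: vs; rewrite inE negb_or => /andP [/eqP].
have [e e0 [ve se]] : exists2 e, e != 0 & 0 < v e /\ forall w, w \in s -> w e < 0.
  by apply: IHs => // w' hw'; apply: ps; rewrite inE hw' orbT.
have [lt|le] := ltP (w e) 0.
  by exists e => //; split=> // w'; rewrite inE => /predU1P [->//|]; exact: se.
have [a a0 [va wa]] := place_separate pv pw nvw.
have [b b0 [wb vb]] := place_separate pw pv (nesym nvw).
pose z := a / b.
have z0 : z != 0 by rewrite mulf_neq0 ?invr_eq0.
have vz : 0 < v z by rewrite (placeM pv) ?invr_eq0 // (placeV pv); lia.
have wz : w z < 0 by rewrite (placeM pw) ?invr_eq0 // (placeV pw); lia.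
(* With r above every |w' e|, z^r dominates e in z^r + e wherever z has a pole on s; at the other
   places of s the pole of e dominates. *)
pose r := (\max_(w' <- s) `|w' e|%N).+1.
have rP w' : w' \in s -> (`|w' e| < r)%N.
  by move=> hw'; rewrite ltnS; exact: leq_bigmax_seq.
have zr0 : z ^+ r != 0 by rewrite expf_neq0.
have [ne we] : z ^+ r + e != 0 /\ w (z ^+ r + e) = w (z ^+ r).
  apply: place_addl => //; right; rewrite (placeX pw).
  by apply: le_trans le; rewrite lezD1 pmulrn_llt0.
exists (z ^+ r + e) => //; split.
  have [/eqP|] : val_ge v 1 (z ^+ r + e); [| by rewrite (negPf ne) |].
    apply: (val_geD pv); right; rewrite -gtz0_ge1 //.
    by rewrite (placeX pv) pmulrn_lgt0.
  by rewrite -gtz0_ge1.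
move=> w'; rewrite inE => /predU1P [->|hw'].
  by rewrite we (placeX pw) pmulrn_llt0.
have pw' : place iota w' by apply: ps; rewrite inE hw' orbT.
have := se _ hw'; have := rP _ hw' => lt ltn.
have [ltz|gez] := ltP (w' z) 0.
  suff [_ ->] : z ^+ r + e != 0 /\ w' (z ^+ r + e) = w' (z ^+ r).
    by rewrite (placeX pw') pmulrn_llt0.
  apply: place_addl => //; right; rewrite (placeX pw').
  have : w' z *+ r <= - r%:Z by rewrite -mulr_natr; nia.
  by lia.
suff [_ e'] : e + z ^+ r != 0 /\ w' (e + z ^+ r) = w' e by rewrite addrC e'.
apply: place_addl => //; right; rewrite (placeX pw').
by apply: (@le_trans _ _ 0); [rewrite lezD1 | rewrite mulrn_wge0].
Qed.

(** Take 1 / (1 + e) with e from [place_approx]: poles of e become zeros, and 1 + e is a unit where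
    e vanishes. *)
Lemma place_indicator v (s : seq (K -> int)) : place iota v ->
  (forall w, w \in s -> place iota w) -> v \notin s ->
  exists2 e, e != 0 & v e = 0 /\ forall w, w \in s -> 0 < w e.
Proof.
move=> pv ps vs; have [e e0 [ve se]] := place_approx pv ps vs.
have [n0 v1] : 1 + e != 0 /\ v (1 + e) = v 1.
  apply: place_addl => //; first exact: oner_neq0.
  by right; rewrite (place1 pv) add0r -gtz0_ge1.
exists (1 + e)^-1; first by rewrite invr_eq0.
split; first by rewrite (placeV pv) v1 (place1 pv).
move=> w hw; have pw := ps w hw; rewrite (placeV pw) oppr_gt0 [1 + e]addrC.
have [_ ->] : e + 1 != 0 /\ w (e + 1) = w e; last exact: se.
- by apply: place_addl => //; right; rewrite (place1 pw) lezD1; exact: se.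
Qed.

Hypothesis ff : function_field1 iota.

(** Given R + 1 zeros w_i of x, choose e_i that is a unit at w_i and vanishes at the other w_j. In a
    normalized relation between the e_i over k[x], some c_i(0) != 0; at w_i the i-th term is then a
    unit and all others vanish, which is absurd. *)
Lemma finite_zeros x : x != 0 -> finite_set [set v | place iota v /\ 0 < v x].
Proof.
move=> x0; apply: contrapT => inf.
have tx : transcendental iota x.
  have [v [pv vx]] : [set v | place iota v /\ 0 < v x] !=set0.
    by apply/set0P; apply: contra_notN inf => /eqP ->; exact: finite_set0.
  by apply: (place_transcendental pv); rewrite gt_eqF.
have [R bd] := function_field1_bounded_dep ff tx.
have [B Bsub cB] := infinite_set_fset R.+1 inf.
have [s us [ss hs]] : exists2 s : seq (K -> int), uniq s &
    size s = R.+1 /\ forall v, v \in s -> place iota v /\ 0 < v x.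
  exists (take R.+1 (enum_fset B)); first by rewrite take_uniq // fset_uniq.
  split; first by rewrite size_takel.
  by move=> v /mem_take hv; exact: Bsub.
pose w i := nth (fun=> 0) s i.
have hw (i : 'I_R.+1) : w i \in s by rewrite mem_nth // ss.
have /choice [e he] : forall i : 'I_R.+1, exists e, [/\ e != 0, w i e = 0 &
    forall j : 'I_R.+1, j != i -> 0 < w j e].
  move=> i; have [||//|e e0 [h1 h2]] := place_indicator (v := w i) (s := rem (w i) s).
  - by case: (hs _ (hw i)).
  - by move=> v /mem_rem hv; case: (hs v hv).
  - by rewrite mem_rem_uniq // !inE eqxx.
  exists e; split=> // j ji; apply: h2; rewrite mem_rem_uniq // !inE hw andbT.
  by rewrite nth_uniq ?ss.
have [c [[i ci] hc]] := bounded_dep_norm e tx bd.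
have [pwi wix] := hs _ (hw i).
have gx (j : 'I_R.+1) : val_ge (w j) 1 x.
  by right; rewrite -gtz0_ge1; case: (hs _ (hw j)).
have [e0 ei _] := he i.
have [n0 vi] := place_peval pwi (gx i) ci.
have [] : peval x (c i) * e i != 0 /\ w i (peval x (c i) * e i) = 0.
  by rewrite mulf_neq0 // (placeM pwi) // vi ei.
move=> ne ve; have : val_ge (w i) 1 (peval x (c i) * e i).
  have -> : peval x (c i) * e i = - \sum_(j | j != i) peval x (c j) * e j.
    by apply/eqP; rewrite -addr_eq0 -[X in _ == X]hc [X in _ == X](bigD1 i).
  apply: (val_geN pwi); apply: (val_ge_sum pwi) => j ji.
  apply: (val_geMl pwi).
    by apply: (val_ge_peval pwi); apply: val_ge_le (gx i).
  by right; rewrite -gtz0_ge1; case: (he j) => _ _; apply; rewrite eq_sym.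
by apply: val_ge_not => //; rewrite ve.
Qed.

Lemma finite_place_support x : finite_set [set v | place iota v /\ v x != 0].
Proof.
have [->|x0] := eqVneq x 0.
  apply: (sub_finite_set _ (@finite_set0 _)) => v [pv].
  by rewrite (place0 pv) eqxx.
have h1 := finite_zeros x0.
have h2 : finite_set [set v | place iota v /\ 0 < v x^-1].
  by apply: finite_zeros; rewrite invr_eq0.
have h12 := (conj h1 h2); rewrite -finite_setU in h12.
apply: sub_finite_set h12 => v [pv vx].
have [lt|le] := ltP 0 (v x); first by left.
by right; split=> //; rewrite (placeV pv) oppr_gt0 lt_neqAle vx.
Qed.

End PlaceTheory.

(** * Finite generation of rings of regular functions *)

Section Finiteness.
Variables (k K : fieldType) (iota : {rmorphism k -> K}).
Local Notation peval := (peval iota).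

(** A family in [Q] of largest size independent modulo [P] spans: when u is added, its coefficient
    in a dependence relation is nonzero, and one may divide by it because [P] is stable under
    scalars. *)
Lemma finite_span_mod (P Q : set K) (R : nat) :
  (forall a u, P u -> P (iota a * u)) ->
  (forall u : 'I_R.+1 -> K, (forall i, Q (u i)) -> exists a : 'I_R.+1 -> k,
     (exists i, a i != 0) /\ P (\sum_i iota (a i) * u i)) ->
  exists (s : nat) (b : 'I_s -> K), (forall i, Q (b i)) /\
    forall u, Q u -> exists a : 'I_s -> k, P (u - \sum_i iota (a i) * b i).
Proof.
move=> Pscale dep.
pose indep s := exists b : 'I_s -> K, (forall i, Q (b i)) /\
  forall a : 'I_s -> k, P (\sum_i iota (a i) * b i) -> forall i, a i = 0.
have indepR d : ~ indep (d + R.+1)%N.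
  elim: d => [|d IHd] [b [Qb hb]].
    by have [a [[i ai] /hb ha]] := dep b Qb; move: ai; rewrite (ha i) eqxx.
  apply: IHd; exists (fun i => b (lift ord0 i)); split=> // a Pa i.
  have := hb (fun j => if unlift ord0 j is Some j' then a j' else 0).
  rewrite big_ord_recl unlift_none rmorph0 mul0r add0r => /(_ _ (lift ord0 i)).
  rewrite liftK; apply; rewrite (eq_bigr (fun i => iota (a i) * b (lift ord0 i))) //.
  by move=> j _; rewrite liftK.
have ex : exists s, `[< indep s >].
  by exists 0%N; apply/asboolP; exists (fun=> 0); split=> [|a _] [].
have bd s : `[< indep s >] -> (s <= R)%N.
  move/asboolP => hs; rewrite leqNgt; apply/negP => lt.
  by apply: (@indepR (s - R.+1)%N); rewrite subnK.
case: (ex_maxnP ex bd) => s /asboolP [b [Qb hb]] smax.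
exists s, b; split=> // u Qu.
pose b' i := if unlift ord0 i is Some j then b j else u.
have [a [Pa [i ai]]] : exists a : 'I_s.+1 -> k,
    P (\sum_i iota (a i) * b' i) /\ exists i, a i <> 0.
  apply: contrapT => h; have : (s.+1 <= s)%N; last by rewrite ltnn.
  apply/smax/asboolP; exists b'; split=> [i|a Pa i].
    by rewrite /b'; case: unliftP.
  by apply: contrapT => ai; apply: h; exists a; split=> //; exists i.
move: Pa; rewrite big_ord_recl {1}/b' unlift_none.
rewrite (eq_bigr (fun i => iota (a (lift ord0 i)) * b i)) => [Pa|j _]; last first.
  by rewrite /b' liftK.
have a0 : a ord0 != 0.
  apply/eqP => e; case: ai; move: Pa; rewrite e rmorph0 mul0r add0r => /hb h.
  by case: (unliftP ord0 i) => [j ->|->].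
exists (fun i => - a (lift ord0 i) / a ord0).
have -> : u - \sum_i iota (- a (lift ord0 i) / a ord0) * b i =
    iota (a ord0)^-1 * (iota (a ord0) * u + \sum_i iota (a (lift ord0 i)) * b i).
  rewrite mulrDr mulrA -rmorphM mulVf // rmorph1 mul1r -sumrN mulr_sumr.
  congr (_ + _); apply: eq_bigr => j _.
  by rewrite mulNr rmorphN mulNr opprK mulrA -rmorphM [a _ / _]mulrC.
exact: Pscale.
Qed.

Lemma regular_functionsB (W : set (K -> int)) u w : W `<=` place iota ->
  regular_functions W u -> regular_functions W w -> regular_functions W (u - w).
Proof. by move=> Wp hu hw v Wv; apply: (val_geB (Wp v Wv)); [exact: hu | exact: hw]. Qed.

Lemma regular_functionsM (W : set (K -> int)) u w : W `<=` place iota ->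
  regular_functions W u -> regular_functions W w -> regular_functions W (u * w).
Proof. by move=> Wp hu hw v Wv; apply: (val_geMl (Wp v Wv)); [exact: hu | exact: hw]. Qed.

Lemma regular_functions_sum (W : set (K -> int)) (I : Type) (s : seq I) (F : I -> K) :
  W `<=` place iota -> (forall i, regular_functions W (F i)) ->
  regular_functions W (\sum_(i <- s) F i).
Proof. by move=> Wp h v Wv; apply: (val_ge_sum (Wp v Wv)) => i _; exact: h. Qed.

Lemma regular_functions_peval (W : set (K -> int)) u q : W `<=` place iota ->
  regular_functions W u -> regular_functions W (peval u q).
Proof. by move=> Wp hu v Wv; apply: (val_ge_peval (Wp v Wv)); exact: hu. Qed.

Lemma regular_functionsX (W : set (K -> int)) u n : W `<=` place iota ->
  regular_functions W u -> regular_functions W (u ^+ n).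
Proof. by move=> Wp hu v Wv; apply: (val_geX (Wp v Wv)); exact: hu. Qed.

Lemma regular_functions_iota (W : set (K -> int)) a : W `<=` place iota ->
  regular_functions W (iota a).
Proof. by move=> Wp v Wv; exact: val_ge_iota (Wp v Wv) a. Qed.

Hypothesis ff : function_field1 iota.

Lemma place_bounded u : exists m : nat, forall v, place iota v -> (`|v u| <= m)%N.
Proof.
have /finite_seqP [s e] := finite_place_support ff u.
exists (\max_(v <- s) `|v u|)%N => v pv.
have [->//|vu] := eqVneq (v u) 0.
by apply: leq_bigmax_seq => //; have : [set` s] v by rewrite -e.
Qed.

(** * The functions regular where t is regular form a finite k[t]-module *)

Section OverPolynomials.
Variable t : K.
Hypothesis tt : transcendental iota t.

Let W0 := [set v | place iota v /\ val_ge v 0 t].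
Let Woo := [set v | place iota v /\ v t < 0].
Let M := regular_functions W0.
Let N := regular_functions Woo.
Let W0p : W0 `<=` place iota. Proof. by move=> v []. Qed.
Let Woop : Woo `<=` place iota. Proof. by move=> v []. Qed.
Let t0 : t != 0. Proof. exact: transcendental_neq0 tt. Qed.
Let Mt : M t. Proof. by move=> v []. Qed.
Let NtV : N t^-1.
Proof. by move=> v [pv vt]; right; rewrite (placeV pv) oppr_ge0 ltW. Qed.

(** This bounds the dimension of N / t^-1 N: in a normalized relation over k[t^-1], each coefficient
    is congruent to its constant term modulo t^-1 N. *)
Let N_dep : exists R, forall u : 'I_R.+1 -> K, (forall i, N (u i)) ->
  exists a : 'I_R.+1 -> k, (exists i, a i != 0) /\
    N ((\sum_i iota (a i) * u i) * t).
Proof.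
have tV := transcendentalV tt.
have [R bd] := function_field1_bounded_dep ff tV.
exists R => u Nu; have [c [nc hc]] := bounded_dep_norm u tV bd.
exists (fun i => (c i)`_0); split=> //.
have /choice [r hr] : forall i, exists r,
  peval t^-1 (c i) - iota (c i)`_0 = t^-1 * peval t^-1 r.
  by move=> i; exact: peval_sub_coef0.
have -> : (\sum_i iota (c i)`_0 * u i) * t = \sum_i - peval t^-1 (r i) * u i.
  transitivity (\sum_i (iota (c i)`_0 - peval t^-1 (c i)) * u i * t).
    rewrite -mulr_suml; congr (_ * _); apply/eqP; rewrite -subr_eq0 -sumrB.
    rewrite -[X in _ == X]hc; apply/eqP; apply: eq_bigr => i _; ring.
  apply: eq_bigr => i _; rewrite -opprB hr; field.
  exact: t0.
apply: (regular_functions_sum _ Woop) => i.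
apply: (regular_functionsM Woop); last exact: Nu.
move=> v Wv; apply: (val_geN (Woop Wv)).
exact: (regular_functions_peval _ Woop NtV).
Qed.

(** Such a u has no poles, and it vanishes at the poles of t, of which there is at least one. If u
    were nonzero it would be transcendental, and then u^-1 would have a zero, that is, u a pole. *)
Let MN0 u : M u -> N (u * t) -> u = 0.
Proof.
move=> Mu Nut; apply/eqP; apply: contrapT => /negP u0.
have pos v : place iota v -> 0 <= v u.
  move=> pv; have [vt|vt] := ltP (v t) 0.
    have [||] := Nut v; first by [].
      by move/eqP; rewrite mulf_eq0 (negPf u0) (negPf t0).
    by rewrite (placeM pv) //; lia.
  have [||//] := Mu v; first by split=> //; right.
  by move/eqP; rewrite (negPf u0).
have [v [pv vt]] := exists_place ff (transcendentalV tt).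
rewrite (placeV pv) oppr_gt0 in vt.
have tu : transcendental iota u.
  apply: (place_transcendental pv); rewrite gt_eqF //.
  have [||] := Nut v; first by [].
    by move/eqP; rewrite mulf_eq0 (negPf u0) (negPf t0).
  by rewrite (placeM pv) //; lia.
have [w [pw]] := exists_place ff (transcendentalV tu).
by rewrite (placeV pw) oppr_gt0 ltNge pos.
Qed.

(** The Riemann-Roch space of n times the polar divisor of t. *)
Let L n : set K := [set u | M u /\ N (u / t ^+ n)].

Let gen (I : finType) (g : I -> K) (u : K) : Prop :=
  exists a : I -> {poly k}, u = \sum_i peval t (a i) * g i.

Let genD (I : finType) (g : I -> K) u w : gen g u -> gen g w -> gen g (u + w).
Proof.
move=> [a ->] [b ->]; exists (fun i => a i + b i); rewrite -big_split.
by apply: eq_bigr => i _; rewrite rmorphD mulrDl.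
Qed.

Let gen_inl (I J : finType) (g : I -> K) (h : J -> K) u :
  gen g u -> gen (fun z : I + J => match z with inl i => g i | inr j => h j end) u.
Proof.
move=> [a ->]; exists (fun z => if z is inl i then a i else 0).
rewrite big_sumType /= [X in _ + X]big1 ?addr0 // => j _.
by rewrite rmorph0 mul0r.
Qed.

Let gen_inr (I J : finType) (g : I -> K) (h : J -> K) u :
  gen h u -> gen (fun z : I + J => match z with inl i => g i | inr j => h j end) u.
Proof.
move=> [a ->]; exists (fun z => if z is inr j then a j else 0).
rewrite big_sumType /= [X in X + _]big1 ?add0r // => j _.
by rewrite rmorph0 mul0r.
Qed.

(* Functions of pole order at most [n] are reduced modulo those of pole order
   at most [n - 1] by comparing leading terms, which live in [N / t^-1 N]. *)
Let L_reduce (s : nat) (b : 'I_s -> K) (e : 'I_s -> nat) n :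
  (forall i, M (b i * t ^+ e i)) -> (forall i, (e i <= n)%N) ->
  forall u (a : 'I_s -> k), M u ->
  N ((u / t ^+ n - \sum_i iota (a i) * b i) * t) ->
  exists u', [/\ M u', N (u' / t ^+ n * t) &
    gen (fun i => b i * t ^+ e i) (u - u')].
Proof.
move=> Mb le u a Mu Nu.
pose w := \sum_i peval t ((a i)%:P * 'X^(n - e i)) * (b i * t ^+ e i).
have wE : w = (\sum_i iota (a i) * b i) * t ^+ n.
  rewrite mulr_suml; apply: eq_bigr => i _.
  rewrite rmorphM /= rmorphXn /= pevalC pevalX -[in RHS](subnK (le i)) exprD.
  by ring.
exists (u - w); split.
- apply: (regular_functionsB W0p Mu); apply: (regular_functions_sum _ W0p) => i.
  by apply: (regular_functionsM W0p); [exact: regular_functions_peval | exact: Mb].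
- by rewrite wE mulrBl mulfK // expf_neq0.
- by rewrite opprB addrC subrK; exists (fun i => (a i)%:P * 'X^(n - e i)).
Qed.

Let P := [set z | N (z * t)].
Let Pscale a u : P u -> P (iota a * u).
Proof.
by move=> Pu; rewrite /P /= -mulrA; apply: (regular_functionsM Woop) => //;
  exact: regular_functions_iota.
Qed.

(** Induction on the pole order, adding at each order lifts of a basis of the leading terms. At
    order 0 the remainder lies in M and in t^-1 N, hence is 0. *)
Let L_generated n : exists (I : finType) (g : I -> K),
  (forall i, M (g i)) /\ forall u, L n u -> gen g u.
Proof.
have [R dep] := N_dep.
have step m : exists (s : nat) (b : 'I_s -> K), (forall i, M (b i)) /\
    forall u, L m u -> exists u', [/\ M u', N (u' / t ^+ m * t) & gen b (u - u')].
  have [|s [b [Qb hb]]] := @finite_span_mod P [set w | N w /\ M (w * t ^+ m)] R Pscale.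
    by move=> u Qu; apply: dep => i; case: (Qu i).
  exists s, (fun i => b i * t ^+ m); split=> [i|u [Mu Nu]]; first by case: (Qb i).
  have [|a Pa] := hb (u / t ^+ m).
    by split=> //=; rewrite divfK // expf_neq0.
  by apply: (L_reduce (e := fun=> m) _ _ Mu Pa) => // i; case: (Qb i).
elim: n => [|n [J [h [Mh hJ]]]].
  have [s [b [Mb hb]]] := step 0%N.
  exists 'I_s, b; split=> // u /hb [u' [Mu' Nu']].
  by rewrite (MN0 Mu') ?subr0 //; rewrite expr0 divr1 in Nu'.
have [s [b [Mb hb]]] := step n.+1.
exists ('I_s + J)%type, (fun z => match z with inl i => b i | inr j => h j end).
split=> [[]//|u /hb [u' [Mu' Nu' gu]]].
rewrite -[u](subrK u'); apply: genD; first exact: gen_inl.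
apply/gen_inr/hJ; split=> //.
suff <- : u' / t ^+ n.+1 * t = u' / t ^+ n by [].
by rewrite exprSr invfM mulrA divfK.
Qed.

(** The leading terms of all pole orders together span a finite dimensional space. Lifts b_i t^(e_i)
    of a basis, multiplied by powers of t, lower every pole order above n0 = max e_i; what remains
    lies in [L n0], for which [L_generated] supplies generators. *)
Lemma regular_functions_fg : exists (r : nat) (b : 'I_r -> K),
  (forall l, M (b l)) /\
  forall u, M u -> exists a : 'I_r -> {poly k}, u = \sum_l peval t (a l) * b l.
Proof.
suff [I [g [Mg hg]]] : exists (I : finType) (g : I -> K),
    (forall i, M (g i)) /\ forall u, M u -> gen g u.
  exists #|I|, (fun i => g (enum_val i)); split=> // u /hg [a ->].
  exists (fun i => a (enum_val i)).
  by rewrite -(big_enum_val (A := I) (fun i => peval t (a i) * g i)) /=.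
have [R dep] := N_dep.
have [|s [b [Qb hb]]] := @finite_span_mod P
    [set w | N w /\ exists n : nat, M (w * t ^+ n)] R Pscale.
  by move=> u Qu; apply: dep => i; case: (Qu i).
have /choice [e he] : forall i, exists n : nat, M (b i * t ^+ n).
  by move=> i; case: (Qb i).
pose n0 := \max_i e i.
have [J [h [Mh hJ]]] := L_generated n0.
exists ('I_s + J)%type,
  (fun z => match z with inl i => b i * t ^+ e i | inr j => h j end).
split=> [[]//|u Mu].
have [n Lnu] : exists n, L n u.
  have [n hn] := place_bounded u; exists n; split=> // v [pv vt].
  have [->|u0] := eqVneq u 0; first by rewrite mul0r; left.
  right; rewrite (placeM pv) ?invr_eq0 ?expf_neq0 // (placeV pv) (placeX pv).
  have := hn v pv; rewrite -mulr_natr natz; nia.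
have small m w : (m <= n0)%N -> L m w -> L n0 w.
  move=> le [Mw Nw]; split=> //.
  have -> : w / t ^+ n0 = w / t ^+ m * t^-1 ^+ (n0 - m).
    by rewrite exprVn -mulrA -invfM -exprD subnKC.
  by apply: (regular_functionsM Woop) => //; exact: (regular_functionsX _ Woop NtV).
elim: n u Mu Lnu => [|n IHn] u Mu Lnu; first exact/gen_inr/hJ/(small _ _ _ Lnu).
have [le|lt] := leqP n.+1 n0; first exact/gen_inr/hJ/(small _ _ _ Lnu).
case: Lnu => _ Nu.
have [|a Pa] := hb (u / t ^+ n.+1).
  by split=> //; exists n.+1; rewrite divfK // expf_neq0.
have le i : (e i <= n.+1)%N by apply: leq_trans (ltnW lt); exact: leq_bigmax.
have [u' [Mu' Nu' gu]] := L_reduce he le Mu Pa.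
rewrite -[u](subrK u'); apply: genD; first exact: gen_inl.
apply: IHn => //; split=> //.
suff <- : u' / t ^+ n.+1 * t = u' / t ^+ n by [].
by rewrite exprSr invfM mulrA divfK.
Qed.

End OverPolynomials.

(** In t^(m+1) + y, with m bounding |v y| at all places, no pole of t can cancel; and where both
    this sum and t are regular, so is y. *)
Lemma pole_cover (A : set K) (s : seq K) : A 0 ->
  (forall u w, A u -> A w -> A (u + w)) -> (forall u n, A u -> A (u ^+ n.+1)) ->
  (forall y, y \in s -> A y) ->
  exists2 t, A t & forall v, place iota v -> val_ge v 0 t ->
    forall y, y \in s -> val_ge v 0 y.
Proof.
move=> A0 Aadd Aexp; elim: s => [|y s IHs] As; first by exists 0.
have [|t At ht] := IHs; first by move=> z hz; apply: As; rewrite inE hz orbT.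
have [m hm] := place_bounded y.
exists (t ^+ m.+1 + y); first by apply: Aadd; [exact: Aexp | apply: As; rewrite inE eqxx].
move=> v pv hv; suff vt : val_ge v 0 t.
  move=> z; rewrite inE => /predU1P [->|]; last exact: ht.
  rewrite -[y](addKr (t ^+ m.+1)) addrC.
  by apply: (val_geB pv hv); exact: (val_geX pv).
have [le|lt] := leP 0 (v t); first by right.
have t0 : t != 0 by apply/eqP => e; move: lt; rewrite e (place0 pv) ltxx.
have vtm : v (t ^+ m.+1) + 1 <= - m%:Z by rewrite (placeX pv) -mulr_natr natz; nia.
have [||n0 e] := @place_addl _ _ iota v pv (t ^+ m.+1) y.
- by rewrite expf_neq0.
- by right; have := hm v pv; lia.
by exfalso; apply: (val_ge_not n0 _ hv); rewrite e; lia.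
Qed.

End Finiteness.

(** * Centers of places in projective space *)

Section Centers.
Variables (k : fieldType) (n : nat) (K : fieldType) (iota : {rmorphism k -> K}).
Local Notation S := {mpoly k[n.+1]}.
Local Notation peval := (peval iota).
Implicit Types (g h : S) (G : 'I_n.+1 -> K) (v : K -> int) (I : set S).

Lemma ev_is_zmod_morphism G : zmod_morphism (ev iota G).
Proof. by move=> g h; rewrite /ev rmorphB. Qed.

Lemma ev_is_monoid_morphism G : monoid_morphism (ev iota G).
Proof. by split=> [|g h]; rewrite /ev ?rmorph1 ?rmorphM. Qed.

HB.instance Definition _ G :=
  GRing.isZmodMorphism.Build _ _ (ev iota G) (ev_is_zmod_morphism G).
HB.instance Definition _ G :=
  GRing.isMonoidMorphism.Build _ _ (ev iota G) (ev_is_monoid_morphism G).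

Lemma evZ G c g : ev iota G (c *: g) = iota c * ev iota G g.
Proof. exact: mmapZ. Qed.

Lemma evX G i : ev iota G 'X_i = G i.
Proof. by rewrite /ev mmapX mmap1U. Qed.

Lemma ev_peval G h (q : {poly k}) :
  ev iota G (\sum_(i < size q) q`_i *: h ^+ i) = peval (ev iota G h) q.
Proof.
rewrite rmorph_sum pevalE; apply: eq_bigr => i _.
by rewrite /= evZ rmorphXn.
Qed.

Lemma homog_component_sum g : exists d, g = \sum_(e < d) homog_component e g.
Proof. by exists (mmeasure mdeg g); exact: pihomog_partitionE. Qed.

Lemma homog_component_id d g : homog_of d g -> homog_component d g = g.
Proof. exact: pihomog_dE. Qed.

Lemma homog_component_neq d e g : d != e -> homog_of d g -> homog_component e g = 0.
Proof. exact: pihomog_ne0. Qed.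

Lemma homog_componentP d g : homog_of d (homog_component d g).
Proof. exact: pihomogP. Qed.

Lemma ev_homog_scale G d g c : homog_of d g ->
  ev iota (fun i => c * G i) g = c ^+ d * ev iota G g.
Proof.
move/dhomogP => hg; rewrite /ev /mmap mulr_sumr big_seq [RHS]big_seq.
apply: eq_bigr => m /hg <-; rewrite mulrCA; congr (_ * _).
rewrite /mmap1; under eq_bigr => i _ do rewrite exprMn.
rewrite big_split /= mdegE; congr (_ * _).
by rewrite prodrXr.
Qed.

(* [g(G_0 T, ..., G_n T)], whose coefficient in degree [d] is the value at [G]
   of the degree [d] component of [g]. *)
Definition homog_poly G g : {poly K} :=
  mmap (polyC \o iota) (fun i => G i *: 'X) g.

Lemma homog_polyM G g h : homog_poly G (g * h) = homog_poly G g * homog_poly G h.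
Proof. exact: rmorphM. Qed.

Lemma coef_homog_poly G g d :
  (homog_poly G g)`_d = ev iota G (homog_component d g).
Proof.
rewrite /homog_component pihomogE rmorph_sum /homog_poly /mmap coef_sum.
rewrite [RHS]big_mkcond /=; apply: eq_bigr => m _.
rewrite evZ /ev mmapX coefCM /=.
have -> : mmap1 (fun i => G i *: 'X) m = mmap1 G m *: 'X^(mdeg m) :> {poly K}.
  rewrite /mmap1; under eq_bigr => i _ do rewrite exprZn.
  by rewrite scaler_prod prodrXr mdegE.
by rewrite coefZ coefXn [_ == d]eq_sym; case: eqP => _; rewrite ?mulr1 ?mulr0.
Qed.

Section AtPlace.
Variables (F : 'I_n.+1 -> K) (v : K -> int).
Hypothesis pv : place iota v.

Lemma val_ge_ev G g : (forall i, val_ge v 0 (G i)) -> val_ge v 0 (ev iota G g).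
Proof.
move=> hG; apply: (val_ge_sum pv) => m _; apply: (val_geMl pv).
  exact: val_ge_iota.
rewrite /mmap1; elim/big_ind : _ => [||i _]; first exact: (val_ge1 pv).
  by move=> a b; exact: (val_geMl pv).
exact: (val_geX pv).
Qed.

Lemma coordinates_at_exists : (exists i, F i != 0) -> exists G, coordinates_at F v G.
Proof.
move=> [i0 Fi0].
have [i Fi imin] : exists2 i, F i != 0 & forall j, F j != 0 -> v (F i) <= v (F j).
  case: (Order.TotalTheory.arg_minP (P := fun i => F i != 0) (fun i => v (F i)) Fi0).
  by move=> i; exists i.
exists (fun j => (F i)^-1 * F j); split.
- by exists (F i)^-1 => //; rewrite invr_eq0.
- move=> j; have [->|Fj] := eqVneq (F j) 0; first by rewrite mulr0; left.
  by right; rewrite (placeM pv) ?invr_eq0 // (placeV pv) addrC subr_ge0 imin.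
- by exists i; rewrite mulVf // (place1 pv) oner_neq0.
Qed.

Lemma coordinates_at_unit G G' : coordinates_at F v G -> coordinates_at F v G' ->
  exists2 c, c != 0 & val_ge v 0 c /\ forall i, G' i = c * G i.
Proof.
move=> [[a a0 Ga] _ [i [Gi vGi]]] [[b b0 Gb] G'0 _].
exists (b / a); first by rewrite mulf_neq0 ?invr_eq0.
have e j : G' j = b / a * G j by rewrite Ga Gb mulrA divfK.
split=> //; have := G'0 i; rewrite e => -[/eqP|].
  by rewrite mulf_eq0 (negPf Gi) orbF => /eqP ->; left.
by rewrite (placeM pv) ?mulf_neq0 ?invr_eq0 // vGi addr0; right.
Qed.

Lemma centerP G g : coordinates_at F v G ->
  center iota F v g <-> forall d, val_ge v 1 (ev iota G (homog_component d g)).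
Proof.
move=> hG; split=> [[G' hG' h] d|h]; last by exists G.
have [c c0 [vc e]] := coordinates_at_unit hG' hG.
rewrite (_ : G = fun i => c * G' i); last exact/funext.
rewrite (ev_homog_scale _ _ (@homog_componentP d g)).
by apply: (val_geMl pv) => //; exact: (val_geX pv).
Qed.

Lemma center_coefP G g : coordinates_at F v G ->
  center iota F v g <-> forall d, val_ge v 1 (homog_poly G g)`_d.
Proof.
move=> hG; rewrite (centerP _ hG).
by split=> h d; move: (h d); rewrite coef_homog_poly.
Qed.

Lemma center_homogP G d g : coordinates_at F v G -> homog_of d g ->
  center iota F v g <-> val_ge v 1 (ev iota G g).
Proof.
move=> hG hg; rewrite (centerP _ hG); split=> [/(_ d)|h e].
  by rewrite homog_component_id.
have [<-|de] := eqVneq d e; first by rewrite homog_component_id.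
by rewrite (homog_component_neq de hg) rmorph0; left.
Qed.

Lemma homog_of_X i : homog_of 1 ('X_i : S).
Proof. by rewrite /homog_of /= dhomogX; apply/eqP; exact: mdeg1. Qed.

Lemma center_point : (exists i, F i != 0) -> Defs.point (center iota F v).
Proof.
move=> F0; have [G hG] := coordinates_at_exists F0.
have [_ G0 [i [Gi vGi]]] := hG.
have coef0 g d : val_ge v 0 (homog_poly G g)`_d.
  by rewrite coef_homog_poly; exact: val_ge_ev.
have Ccoef g := center_coefP g hG; have Cev g := centerP g hG.
split.
- split.
  + by apply/Cev => d; rewrite /homog_component !raddf0; left.
  + move=> g h /Cev hg /Cev hh; apply/Cev => d.
    by rewrite /homog_component !raddfD; apply: (val_geD pv); [exact: hg | exact: hh].
  + move=> g h /Ccoef hh; apply/Ccoef => d; rewrite homog_polyM coefM.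
    by apply: (val_ge_sum pv) => j _; exact: (val_geMl pv).
  + move=> d g /Cev hg; apply/(center_homogP hG (@homog_componentP d g)).
    exact: hg.
- move/(center_homogP (d := 0) hG) => h.
  have : val_ge v 1 (ev iota G 1) by apply: h; exact: dhomog1.
  by rewrite rmorph1; apply: val_ge_not; rewrite ?oner_neq0 ?(place1 pv).
(* Primality, as in Gauss's lemma: if d and e are the lowest degrees in which g and h have a unit
   coefficient, then g h has a unit coefficient in degree d + e. *)
- move=> g h /Ccoef hgh; apply: contrapT => /not_orP [ng nh].
  have least g' : ~ center iota F v g' -> exists d,
      ~ val_ge v 1 (homog_poly G g')`_d /\
      forall j, (j < d)%N -> val_ge v 1 (homog_poly G g')`_j.
    move=> hg'; have /existsNP [d0 hd0] : ~ forall d, val_ge v 1 (homog_poly G g')`_d.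
      by move/Ccoef.
    have ex : exists d, ~~ `[< val_ge v 1 (homog_poly G g')`_d >].
      by exists d0; apply/asboolPn.
    case: (ex_minnP ex) => d /asboolPn hd dmin; exists d; split=> // j jd.
    apply: contrapT => hj; move: jd; rewrite ltnNge dmin //.
    exact/asboolPn.
  have [d [hd dmin]] := least _ ng; have [e [he emin]] := least _ nh.
  have unit g' j : ~ val_ge v 1 (homog_poly G g')`_j ->
      (homog_poly G g')`_j != 0 /\ v (homog_poly G g')`_j = 0.
    move=> hj; have n0 : (homog_poly G g')`_j != 0.
      by apply: contra_notN hj => /eqP ->; left.
    split=> //; have [/eqP|le] := coef0 g' j; first by rewrite (negPf n0).
    apply/eqP; rewrite eq_le le andbT leNgt; apply/negP => lt; apply: hj.
    by right; rewrite -gtz0_ge1.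
  have [d0 vd] := unit _ _ hd; have [e0 ve] := unit _ _ he.
  have := hgh (d + e)%N; rewrite homog_polyM coefM.
  have ltd : (d < (d + e).+1)%N by rewrite ltnS leq_addr.
  rewrite (bigD1 (Ordinal ltd)) //= addKn.
  have [||nz vz] := @place_addl _ _ iota v pv
    ((homog_poly G g)`_d * (homog_poly G h)`_e)
    (\sum_(j < (d + e).+1 | j != Ordinal ltd)
       (homog_poly G g)`_j * (homog_poly G h)`_(d + e - j)).
  + by rewrite mulf_neq0.
  + rewrite (placeM pv) // vd ve !add0r; apply: (val_ge_sum pv) => j jd.
    have [lt|gt|ej] := ltngtP j d.
    * by apply: (val_geMr pv) => //; exact: dmin.
    * by apply: (val_geMl pv) => //; apply: emin; have := ltn_ord j; lia.
    * by case/eqP: jd; exact: val_inj.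
  by apply: val_ge_not => //; rewrite vz (placeM pv) // vd ve.
- exists i => /(center_homogP hG (homog_of_X i)); rewrite evX.
  by apply: val_ge_not => //; rewrite vGi.
Qed.

Lemma ev_point_on I G g : homogeneous_ideal I -> point_on iota F I ->
  coordinates_at F v G -> I g -> ev iota G g = 0.
Proof.
move=> [_ _ _ Ic] [_ hF] [[c _ hG] _ _] Ig.
have [d ->] := homog_component_sum g; rewrite rmorph_sum big1 // => e _ /=.
rewrite (_ : G = fun i => c * F i); last exact/funext.
rewrite (ev_homog_scale _ _ (@homog_componentP e g)) hF ?mulr0 //.
exact: Ic.
Qed.

Lemma point_on_center I : homogeneous_ideal I -> point_on iota F I ->
  I `<=` center iota F v.
Proof.
move=> hI hF; have [F0 _] := hF; have [G hG] := coordinates_at_exists F0.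
move=> g Ig; apply/(centerP _ hG) => d; rewrite (ev_point_on hI hF hG) //; first by left.
by case: hI => _ _ _; apply.
Qed.

(** Off D some element h of [ID] is a unit at the center. As s h is a multiple of g modulo [IX] with
    s a unit there, g divides a unit. *)
Lemma local_equation_unit IX ID g G : homogeneous_ideal IX -> homogeneous_ideal ID ->
  point_on iota F IX -> coordinates_at F v G ->
  local_equation IX ID (center iota F v) g -> ~ (ID `<=` center iota F v) ->
  v (ev iota G g) = 0.
Proof.
move=> hIX hID hF hG [_ [_ gen]] /existsNP [h /not_implyP [IDh nch]].
have [_ G0 _] := hG; have [_ _ _ IDc] := hID.
have /existsNP [d hd] : ~ forall d, val_ge v 1 (ev iota G (homog_component d h)).
  by move/(centerP _ hG).
have hom : is_homog (homog_component d h) by exists d; exact: homog_componentP.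
have [s [[ds hs] ns] [a]] := gen _ hom (IDc _ _ IDh).
move/(ev_point_on hIX hF hG); rewrite big_ord1 rmorphB !rmorphM /= => /eqP.
rewrite subr_eq0 => /eqP e.
have unit y : val_ge v 0 y -> ~ val_ge v 1 y -> y != 0 /\ v y = 0.
  move=> y0 y1; have n0 : y != 0 by apply: contra_notN y1 => /eqP ->; left.
  split=> //; case: y0 => [/eqP|le]; first by rewrite (negPf n0).
  apply/eqP; rewrite eq_le le andbT leNgt; apply/negP => lt; apply: y1.
  by right; rewrite -gtz0_ge1.
have [s0 vs] : ev iota G s != 0 /\ v (ev iota G s) = 0.
  by apply: unit; [exact: val_ge_ev | move/(center_homogP hG hs)].
have [h0 vh] := unit _ (val_ge_ev _ G0) hd.
have : ev iota G (a ord0) * ev iota G g != 0 by rewrite -e mulf_neq0.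
rewrite mulf_eq0 negb_or => /andP [a0 g0].
have : v (ev iota G (a ord0)) + v (ev iota G g) = 0.
  by rewrite -(placeM pv) // -e (placeM pv) // vs vh.
have [/eqP|] := val_ge_ev (a ord0) G0; first by rewrite (negPf a0).
have [/eqP|] := val_ge_ev g G0; first by rewrite (negPf g0).
by lia.
Qed.

Lemma center_XP i : F i != 0 ->
  ~ center iota F v 'X_i <-> forall j, val_ge v 0 (F j / F i).
Proof.
move=> Fi; split=> [nc j|h].
  have [G hG] : exists G, coordinates_at F v G by apply: coordinates_at_exists; exists i.
  have [[c c0 e] G0 _] := hG.
  have nGi : ~ val_ge v 1 (G i).
    by rewrite -(evX G); move/(center_homogP hG (homog_of_X i)).
  have Gi : G i != 0 by rewrite e mulf_neq0.
  have vGi : v (G i) <= 0.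
    by rewrite leNgt; apply/negP => lt; apply: nGi; right; rewrite -gtz0_ge1.
  have -> : F j / F i = G j / G i by rewrite !e invfM mulrACA divff // mul1r.
  apply: (val_geMl pv) => //; right; rewrite (placeV pv) oppr_ge0 //.
have hG : coordinates_at F v (fun j => F j / F i).
  split=> //; first by exists (F i)^-1; rewrite ?invr_eq0 // => j; rewrite mulrC.
  by exists i; rewrite divff // oner_neq0 (place1 pv).
move/(center_homogP hG (homog_of_X i)); rewrite evX divff //.
by apply: val_ge_not; rewrite ?oner_neq0 ?(place1 pv).
Qed.

End AtPlace.

(** Among the polynomials in the coordinates F_j / F_i, [pole_cover] finds a t that is regular
    exactly on the chart W; so the functions on W are finite already over k[t]. *)
Lemma place_finite_morphism (F : 'I_n.+1 -> K) : function_field1 iota ->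
  (forall u, exists d a b, [/\ homog_of d a, homog_of d b, ev iota F b != 0
                             & u = ev iota F a / ev iota F b]) ->
  finite_morphism iota F (place iota).
Proof.
move=> ff gen i Fi W; pose y j := F j / F i.
have WP v : W v <-> place iota v /\ forall j, val_ge v 0 (y j).
  by split=> -[pv hv]; split=> //; apply/(center_XP pv Fi).
have Wp : W `<=` place iota by move=> v [].
have Wev g : regular_functions W (ev iota y g).
  by move=> v /WP [pv hv]; exact: val_ge_ev.
have fracy u : exists a b, ev iota y b != 0 /\ u = ev iota y a / ev iota y b.
  have [d [a [b [ha hb nb ->]]]] := gen u.
  have FE c : homog_of d c -> ev iota F c = F i ^+ d * ev iota y c.
    move=> hc; rewrite -(ev_homog_scale _ _ hc); congr (ev iota _ c).
    by apply/funext => j; rewrite mulrC divfK.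
  exists a, b; move: nb; rewrite !FE // mulf_eq0 negb_or => /andP [p0 b0].
  by split=> //; rewrite invfM mulrACA divff // mul1r.
split.
  split=> [u|v pv hv].
    by have [a [b [nb ->]]] := fracy u; exists (ev iota y a), (ev iota y b).
  by apply/WP; split=> // j; rewrite -(evX y); apply: hv.
have [||||t [tau ->] ht] := @pole_cover _ _ iota ff [set u | exists g, u = ev iota y g]
    [seq y j | j : 'I_n.+1].
- by exists 0; rewrite rmorph0.
- by move=> u w [g ->] [h ->]; exists (g + h); rewrite rmorphD.
- by move=> u m [g ->]; exists (g ^+ m.+1); rewrite rmorphXn.
- by move=> z /imageP [j _ ->]; exists 'X_j; rewrite evX.
have {}ht v : place iota v -> val_ge v 0 (ev iota y tau) -> forall j, val_ge v 0 (y j).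
  by move=> pv hv j; apply: (ht v pv hv); apply/imageP; exists j.
have tt : transcendental iota (ev iota y tau).
  (* Otherwise t has no poles, so neither has any F_j / F_i. A polynomial in these has no zeros
     either unless it is 0, since a zero would force a pole elsewhere. So no quotient of two of them
     has a pole, although every element of K is such a quotient and some transcendental x has a
     pole. *)
  apply: contrapT => nt.
  have y0 v j : place iota v -> val_ge v 0 (y j).
    move=> pv; apply: ht => //; right; have [->//|vt] := eqVneq (v (ev iota y tau)) 0.
    by case: nt; exact: (place_transcendental pv).
  have [x [tx _]] := ff.
  have [v [pv]] := exists_place ff (transcendentalV (x := x) tx).
  have [a [b [nb ->]]] := fracy x.
  have vb : v (ev iota y b) = 0.
    apply: contrapT => /eqP vb.
    have [w [pw]] := exists_place ff (transcendentalV (place_transcendental pv vb)).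
    rewrite (placeV pw) oppr_gt0; apply/negP; rewrite -leNgt.
    have [/eqP|//] := val_ge_ev pw b (fun j => y0 w j pw).
    by rewrite (negPf nb).
  rewrite (placeV pv) oppr_gt0; apply/negP; rewrite -leNgt.
  have [a0|a0] := eqVneq (ev iota y a) 0; first by rewrite a0 mul0r (place0 pv).
  rewrite (placeM pv) ?invr_eq0 // (placeV pv) vb oppr0 addr0.
  have [/eqP|//] := val_ge_ev pv a (fun j => y0 v j pv).
  by rewrite (negPf a0).
have WE : W = [set v | place iota v /\ val_ge v 0 (ev iota y tau)].
  apply/seteqP; split=> v; first by move=> Wv; split; [exact: Wp | exact: Wev].
  by move=> [pv hv]; apply/WP; split=> // j; exact: ht.
have [r [b [Mb hb]]] := regular_functions_fg ff tt.
exists r, b; rewrite WE; split=> // u /hb [a ->].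
exists (fun l => \sum_(j < size (a l)) (a l)`_j *: tau ^+ j).
by apply: eq_bigr => l _; rewrite ev_peval.
Qed.

End Centers.

(** * Suslin relations and relations with modulus *)

(* Hensel's lemma for [Y ^+ m = 1 + 'X]: when [f] is a unit congruent to 1, the
   value of [q] at [f - 1] is an approximate [m]-th root of [f]. *)
Lemma truncated_root (k : fieldType) (m e : nat) : (m%:R : k) != 0 ->
  exists q r : {poly k}, q`_0 = 1 /\ q ^+ m - (1 + 'X) = 'X^e * r.
Proof.
move=> m0; elim: e => [|e IHe].
  exists 1, (- 'X); rewrite coef1; split=> //.
  by rewrite expr1n expr0 mul1r opprD addNKr.
(* A correction by c X^0 would change the constant term of q, so exponent 1 is reached directly. *)
have [->|e0] := posnP e.
  exists 1, (- 1); rewrite coef1; split=> //.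
  by rewrite expr1n opprD addNKr expr1 mulrN1.
have [q [r [q0 hr]]] := IHe.
(* Newton's step: q'^m - q^m = c X^e B with B(0) = m, so this c cancels the coefficient of X^e in
   the error. *)
pose c := - r`_0 / m%:R.
pose q' := q + c *: 'X^e.
have q'0 : q'`_0 = 1.
  by rewrite coefD coefZ coefXn q0 eq_sym gtn_eqF // mulr0 addr0.
pose B := \sum_(i < m) q' ^+ (m.-1 - i) * q ^+ i.
have B0 : B`_0 = m%:R.
  rewrite -horner_coef0 horner_sum -[X in _ = X%:R]card_ord -sumr_const.
  apply: eq_bigr => i _.
  by rewrite hornerM !horner_exp !horner_coef0 q0 q'0 !expr1n mulr1.
have /divXpK e1 : (r + c *: B)`_0 = 0.
  by rewrite coefD coefZ B0 divfK // subrr.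
exists q', ((r + c *: B) %/ 'X); split=> //.
have -> : q' ^+ m - (1 + 'X) = (q ^+ m - (1 + 'X)) + (q' ^+ m - q ^+ m) by ring.
rewrite hr subrXX /q' addrAC subrr add0r -/B -scalerAl scalerAr -mulrDr [in LHS]e1.
by rewrite exprSr -!mulrA ['X * _]mulrC.
Qed.

Section Relations.
Variables (k : fieldType) (n : nat).
Local Notation S := {mpoly k[n.+1]}.
Variables IX ID : set S.
Hypothesis hX : projective_variety IX.
Hypothesis hD : effective_cartier_divisor IX ID.
Let U := open_compl IX ID.

Let hIX : homogeneous_ideal IX. Proof. by case: hX. Qed.
Let hID : homogeneous_ideal ID. Proof. by case: hD. Qed.

Section Curve.
Variables (Q : set S) (K : fieldType) (iota : {rmorphism k -> K}).
Variables (F : 'I_n.+1 -> K).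
Hypothesis UQ : U Q.
Hypothesis ff : function_field1 iota.
Hypothesis gen : generic_point_of iota F Q.

Lemma coordinates_neq0 : exists i, F i != 0. Proof. by case: gen. Qed.

Lemma generic_point_on I : homogeneous_ideal I -> point_on iota F I <-> I `<=` Q.
Proof.
move=> hI; have [F0 QF _] := gen; have [_ _ _ Ic] := hI.
have [[[[Q0 Qadd _ _] _ _ _] _] _] := UQ.
split=> [[_ h] g Ig|IQ].
  have [d ->] := homog_component_sum g; elim/big_ind : _ => // e _.
  by apply/(QF _ _ (@homog_componentP _ _ _ _)); apply: h; exact: Ic.
split=> // g Ig; have [d ->] := homog_component_sum g.
rewrite rmorph_sum big1 // => e _ /=.
by apply/(QF _ _ (@homog_componentP _ _ _ _)); apply/IQ/Ic.
Qed.

Lemma generic_point_on_IX : point_on iota F IX.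
Proof. by apply/generic_point_on => //; case: UQ => -[]. Qed.

Lemma generic_point_not_on_ID : ~ point_on iota F ID.
Proof. by move/(generic_point_on hID) => h; case: UQ => -[pQ _]; apply. Qed.

Lemma open_compl_center v : place iota v ->
  U (center iota F v) <-> ~ (ID `<=` center iota F v).
Proof.
move=> pv; have pc := center_point pv coordinates_neq0.
have IXc := point_on_center pv hIX generic_point_on_IX.
by split=> [[_ h] IDc|h]; [apply: h | split=> // -[]].
Qed.

Lemma pullback_divisor_exists : exists E, pullback_divisor iota F IX ID (place iota) E /\
  forall v, place iota v -> 0 < E v -> ~ U (center iota F v).
Proof.
have [_ _ hD'] := hD.
have /choice [E hE] : forall v : K -> int, exists m : int, place iota v -> exists g G,
    [/\ local_equation IX ID (center iota F v) g, coordinates_at F v G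
      & m = v (ev iota G g)].
  move=> v; have [pv|npv] := pselect (place iota v); last by exists 0.
  have [G hG] := coordinates_at_exists pv coordinates_neq0.
  have [|g hg] := hD' (center iota F v).
    split; first exact: center_point pv coordinates_neq0.
    exact: (point_on_center pv hIX generic_point_on_IX).
  by exists (v (ev iota G g)) => _; exists g, G.
exists E; split=> // v pv Ev; have [g [G [hg hG e]]] := hE v pv.
move/(open_compl_center pv) => h; move: Ev; rewrite e.
by rewrite (local_equation_unit pv hIX hID generic_point_on_IX hG hg h) ltxx.
Qed.

(** Passing to the projective model adds only places centered outside U, so multiplicities at points
    of U are unaffected. *)
Lemma push_div_normalization f x : U x ->
  push_div iota F (normalization_over iota F U) f x = push_div iota F (place iota) f x.
Proof.
move=> Ux; apply: eq_fsbigl; apply/seteqP; split=> v [] => [[pv _] e|pv e] //.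
by split=> //; split=> //; rewrite e.
Qed.

Lemma push_divX C f m x : C `<=` place iota ->
  push_div iota F C (f ^+ m) x = push_div iota F C f x *+ m.
Proof.
move=> Cp; rewrite -mulr_natl /push_div mulr_fsumr; apply: eq_fsbigr => v /set_mem [Cv _].
by rewrite (placeX (Cp v Cv)) mulrnAl mulr_natl.
Qed.

(** The sums are split over one finite index set, the places over x where f or g has a zero or a
    pole. *)
Lemma push_divM f g x : f != 0 -> g != 0 ->
  push_div iota F (place iota) (f * g) x =
  push_div iota F (place iota) f x + push_div iota F (place iota) g x.
Proof.
move=> f0 g0; pose T h := [set v | place iota v /\ v h != 0].
have fT : finite_set (T f `|` T g).
  by rewrite finite_setU; split; exact: finite_place_support.
pose A := [set v | place iota v /\ center iota F v = x].
have restrict h : h \in [:: f; g; f * g] -> push_div iota F (place iota) h x =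
    \sum_(v \in A `&` (T f `|` T g)) v h * (residue_degree iota F v)%:Z.
  move=> hh; apply/esym/fsbig_widen; first by move=> v [].
  move=> v [Av nv] /=; have [pv _] := Av.
  have [vf vg] : v f = 0 /\ v g = 0.
    by split; apply/eqP; apply: contra_notT nv => nz; split=> //; [left | right].
  suff -> : v h = 0 by rewrite mul0r.
  move: hh; rewrite !inE => /or3P [] /eqP -> //.
  by rewrite (placeM pv) // vf vg.
rewrite !restrict ?inE ?eqxx ?orbT //.
rewrite !fsbig_finite; try exact: finite_setIr.
rewrite -big_split /= big_seq [RHS]big_seq; apply: eq_bigr => v.
rewrite in_fset_set; last exact: finite_setIr.
by move=> /set_mem [[pv _] _]; rewrite (placeM pv) // mulrDl.
Qed.

Lemma push_div_cycle f : exists w : zero_cycles U,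
  forall x : closed_points U, coeff x w = push_div iota F (place iota) f (val x).
Proof.
have /finite_seqP [s e] := finite_place_support ff f.
pose xs : seq (closed_points U) := undup (pmap insub [seq center iota F v | v <- s]).
pose d (x : closed_points U) := push_div iota F (place iota) f (val x).
exists (\sum_(x <- xs) << d x *g x >>) => x; rewrite raddf_sum /=.
under eq_bigr => y _ do rewrite coeffU.
have [xin|xout] := boolP (x \in xs).
  rewrite (bigD1_seq x) ?undup_uniq //= eqxx mulr1 big1 ?addr0 // => y /negPf ->.
  by rewrite mulr0.
rewrite big_seq big1 => [|y yin]; last first.
  by case: eqP => [yx|_]; rewrite ?mulr0 //; move: xout; rewrite -yx yin.
apply/esym; apply: fsbig1 => v [pv cv].
have [->|vf] := eqVneq (v f) 0; first by rewrite mul0r.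
have vs : v \in s by have : [set` s] v by rewrite -e.
move: xout; rewrite mem_undup mem_pmap_sub => /negP; case.
by apply/mapP; exists v.
Qed.

Lemma modulus_relationsI E g (z : zero_cycles U) :
  pullback_divisor iota F IX ID (place iota) E -> G_group (place iota) E g ->
  (forall x : closed_points U, coeff x z = push_div iota F (place iota) g (val x)) ->
  modulus_relations z.
Proof.
move=> hE hg hz; exists K, iota, (place iota), F, E, g; split=> //.
- by split=> //; split=> //; rewrite setDv; exact: finite_set0.
- split; first exact: generic_point_on_IX.
  by apply: place_finite_morphism => //; case: gen.
- exact: generic_point_not_on_ID.
Qed.

Variable f : K.
Hypothesis hf : G_group (place iota) (C_infty iota F U) f.

Let f0 : f != 0. Proof. by case: hf. Qed.

Lemma G_group_infty v : place iota v -> ~ U (center iota F v) ->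
  v f = 0 /\ val_ge v 1 (f - 1).
Proof.
move=> pv nU; have [_ h] := hf.
have Cv : C_infty iota F U v = 1.
  by rewrite /C_infty; case: asboolP => // -[].
by have := h v pv; rewrite Cv; apply.
Qed.

(** The places where [E] is positive lie at infinity, hence among the zeros of f - 1, of which there
    are finitely many. *)
Lemma pullback_bounded (E : (K -> int) -> int) : f != 1 ->
  (forall v, place iota v -> 0 < E v -> ~ U (center iota F v)) ->
  exists e : nat, forall v, place iota v -> 0 < E v -> E v <= e%:Z.
Proof.
move=> f1 hE; have /finite_seqP [s hs] := finite_place_support ff (f - 1).
exists (\max_(v <- s) `|E v|)%N => v pv Ev.
have vs : v \in s.
  have : [set` s] v; last by [].
  rewrite -hs; split=> //; have [_ [/eqP|]] := G_group_infty pv (hE v pv Ev).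
    by rewrite subr_eq0 (negPf f1).
  by rewrite -gtz0_ge1 => /gt_eqF ->.
rewrite -[E v]gez0_abs; last exact: ltW.
by rewrite lez_nat; exact: leq_bigmax_seq.
Qed.

Variable z : zero_cycles U.
Hypothesis hz : forall x : closed_points U,
  coeff x z = push_div iota F (normalization_over iota F U) f (val x).

Let hz' (x : closed_points U) : coeff x z = push_div iota F (place iota) f (val x).
Proof.
rewrite hz push_div_normalization //.
by case: (set_mem (valP x)).
Qed.

Lemma suslin_relation_pchar p : p \in [pchar k] ->
  exists N, modulus_relations (z *+ p ^ N).
Proof.
move=> pk; have [E [hE EU]] := pullback_divisor_exists.
have [N hN] : exists N : nat, forall v, place iota v -> 0 < E v ->
    val_ge v (E v) (f ^+ (p ^ N) - 1).
  have [->|f1] := eqVneq f 1.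
    by exists 0%N => v _ _; rewrite expr1n subrr; left.
  have [e he] := pullback_bounded f1 EU; exists e => v pv Ev.
  have pp := pcharf_prime pk.
  have -> : f ^+ (p ^ e) - 1 = (f - 1) ^+ (p ^ e).
    have pK : p \in [pchar K] by rewrite (fmorph_pchar iota).
    rewrite -{1}[f](subrK 1) exprDn_pchar ?expr1n ?addrK //.
    by rewrite pnatX pnatE // pK.
  have [_ f1v] := G_group_infty pv (EU v pv Ev).
  (* The bound e on [E] can itself serve as exponent, because e < p^e. *)
  apply: (val_ge_le (m' := 1 *+ p ^ e)).
    apply: le_trans (he v pv Ev) _; rewrite natz lez_nat ltnW // ltn_expl //.
    exact: prime_gt1.
  by apply: (val_ge_expn pv) => //; rewrite expn_gt0 prime_gt0.
exists N; apply: (modulus_relationsI (g := f ^+ (p ^ N)) hE).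
  split; first exact: expf_neq0.
  move=> v pv Ev; split; last exact: hN.
  by rewrite (placeX pv) (G_group_infty pv (EU v pv Ev)).1 mul0rn.
by move=> x; rewrite coeffMn push_divX // hz'.
Qed.

Lemma suslin_relation_mod m : (m%:R : k) != 0 ->
  exists w, modulus_relations (z - w *+ m).
Proof.
move=> m0; have [E [hE EU]] := pullback_divisor_exists.
have trivial_case : (forall v, place iota v -> 0 < E v -> val_ge v (E v) (f - 1)) ->
    exists w, modulus_relations (z - w *+ m).
  move=> h; exists 0; rewrite mul0rn subr0; apply: (modulus_relationsI hE) => //.
  split=> // v pv Ev; split; last exact: h.
  by case: (G_group_infty pv (EU v pv Ev)).
have [f1|f1] := eqVneq f 1.
  by apply: trivial_case => v _ _; rewrite f1 subrr; left.
(* A place with [E] positive is what shows that the approximate root h is nonzero; without one, f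
   itself lies in the group of [E]. *)
have [[v0 [pv0 Ev0]]|nE] := pselect (exists v, place iota v /\ 0 < E v); last first.
  by apply: trivial_case => v pv Ev; case: nE; exists v.
have [e he] := pullback_bounded f1 EU.
have [q [r [q0 hq]]] := truncated_root e m0.
pose h := peval iota (f - 1) q.
have hP v : place iota v -> 0 < E v -> h != 0 /\ v h = 0.
  move=> pv Ev; apply: (place_peval pv); last by rewrite q0 oner_neq0.
  by case: (G_group_infty pv (EU v pv Ev)).
have [h0 _] := hP v0 pv0 Ev0.
have hm0 : h ^+ m != 0 by rewrite expf_neq0.
have [w hw] := push_div_cycle h.
have fE : f = h ^+ m * (f / h ^+ m) by rewrite mulrC divfK.
have g0 : f / h ^+ m != 0 by rewrite mulf_neq0 ?invr_eq0.
exists w; apply: (modulus_relationsI (g := f / h ^+ m) hE); last first.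
  move=> x; rewrite coeffB coeffMn hz' {1}fE push_divM // push_divX // hw.
  by rewrite addrAC subrr add0r.
split=> // v pv Ev; have [vf vf1] := G_group_infty pv (EU v pv Ev).
have [_ vh] := hP v pv Ev.
have vhm : v (h ^+ m)^-1 = 0 by rewrite (placeV pv) (placeX pv) vh mul0rn oppr0.
split; first by rewrite (placeM pv) ?invr_eq0 // vf vhm.
have -> : f / h ^+ m - 1 = - ((f - 1) ^+ e * peval iota (f - 1) r) * (h ^+ m)^-1.
  have := congr1 (peval iota (f - 1)) hq.
  rewrite rmorphB rmorphXn rmorphD rmorph1 rmorphM rmorphXn /= pevalX -/h => <-.
  by rewrite [1 + _]addrC subrK opprB mulrBl divff.
apply: (val_geMr pv); last by right; rewrite vhm.
apply: (val_geN pv); apply: (val_geMr pv).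
  apply: val_ge_le (he v pv Ev) _.
  have [->|e0] := posnP e; first by rewrite expr0; exact: (val_ge1 pv).
  by have := val_ge_expn pv vf1 e0; rewrite natz.
by apply: (val_ge_peval pv); apply: val_ge_le vf1.
Qed.

End Curve.

Lemma suslin_relations_pchar p z : p \in [pchar k] ->
  @suslin_relations k n IX ID z -> exists N, @modulus_relations k n IX ID (z *+ p ^ N).
Proof.
move=> pk [Q [K [iota [F [f [UQ ff gen hf hz]]]]]].
exact: (suslin_relation_pchar UQ ff gen hf hz).
Qed.

Lemma suslin_relations_mod m z : (m%:R : k) != 0 ->
  @suslin_relations k n IX ID z -> exists w, @modulus_relations k n IX ID (z - w *+ m).
Proof.
move=> m0 [Q [K [iota [F [f [UQ ff gen hf hz]]]]]].
exact: (suslin_relation_mod UQ ff gen hf hz).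
Qed.

End Relations.

(** * The induced maps *)

Lemma injective_surjective_bijective (T T' : Type) (f : T -> T') :
  injective f -> (forall y, exists x, f x = y) -> bijective f.
Proof.
move=> inj /choice [g fg]; exists g => // x.
by apply: inj; rewrite fg.
Qed.

Section SpanQuotient.
Variables (V : zmodType) (A : set V).

Lemma subgroup_spanP z : reflect (forall H : set V, H 0 ->
    (forall x y, H x -> H y -> H (x - y)) -> A `<=` H -> H z)
  (z \in subgroup_span A).
Proof. exact: asboolP. Qed.

Lemma mem_subgroup_span z : A z -> z \in subgroup_span A.
Proof. by move=> Az; apply/subgroup_spanP => H _ _; apply. Qed.

Lemma span_projB : {morph span_proj A : x y / x - y}.
Proof. by move=> x y; rewrite /span_proj raddfB. Qed.

Lemma span_proj_eq0 z : span_proj A z = 0 <-> z \in subgroup_span A.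
Proof.
rewrite -[z in z \in _]subr0 Quotient.idealrBE.
have <- : span_proj A 0 = 0 by rewrite -(subrr (0 : V)) span_projB subrr.
by split=> [h|/eqP]; [apply/eqP; exact: h | ].
Qed.

Lemma span_reprK x : span_proj A (span_repr x) = x.
Proof. exact: generic_quotient.reprK. Qed.

HB.instance Definition _ :=
  GRing.isZmodMorphism.Build V (span_quot A) (span_proj A) span_projB.

End SpanQuotient.

Section InducedMap.
Variables (V : zmodType) (A B : set V).
Variable lambda : {additive span_quot A -> span_quot B}.
Hypothesis hlambda : forall z, lambda (span_proj A z) = span_proj B z.

Lemma induced_surjective y : exists x, lambda x = y.
Proof. by exists (span_proj A (span_repr y)); rewrite hlambda span_reprK. Qed.

(** The cycles whose class modulo [A] is killed by a power of p form a subgroup; containing [B], it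
    contains the span of [B]. *)
Lemma induced_kernel_torsion p : (forall z, B z -> exists N, A (z *+ p ^ N)) ->
  forall x, lambda x = 0 -> exists N, x *+ p ^ N = 0.
Proof.
move=> h x; rewrite -(span_reprK x) hlambda.
move/span_proj_eq0/subgroup_spanP => /(_ [set z | exists N, span_proj A z *+ p ^ N = 0]).
apply; first by exists 0%N; rewrite raddf0 mul0rn.
  move=> y z [N hN] [M hM]; exists (N + M)%N.
  rewrite raddfB mulrnBl expnD mulrnA hN mul0rn sub0r.
  by rewrite mulnC mulrnA hM mul0rn oppr0.
move=> z /h [N hN]; exists N; rewrite -raddfMn.
exact/span_proj_eq0/mem_subgroup_span.
Qed.

Lemma induced_kernel_divisible m : (forall z, B z -> exists w, A (z - w *+ m)) ->
  forall x, lambda x = 0 -> exists y, x = y *+ m.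
Proof.
move=> h x; rewrite -(span_reprK x) hlambda.
move/span_proj_eq0/subgroup_spanP => /(_ [set z | exists y, span_proj A z = y *+ m]).
apply; first by exists 0; rewrite raddf0 mul0rn.
  move=> y z [a ha] [b hb]; exists (a - b).
  by rewrite raddfB /= ha hb mulrnBl.
move=> z /h [w hw]; exists (span_proj A w); apply/eqP.
rewrite -raddfMn -subr_eq0 -raddfB; apply/eqP.
exact/span_proj_eq0/mem_subgroup_span.
Qed.

End InducedMap.

Section LocalizationMap.
Variables (p : nat) (V W : zmodType) (f : {additive V -> W}).

Lemma localization_map_frac a i :
  localization_map (p := p) f (Defs.frac p a i) = Defs.frac p (f a) i.
Proof.
have /fracP [r hr] := fracK (Defs.frac p a i).
by apply/fracP; exists r; rewrite -raddfMn hr raddfMn.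
Qed.

Lemma localization_map_iso : (forall y, exists x, f x = y) ->
  (forall x, f x = 0 -> exists N, x *+ p ^ N = 0) ->
  group_isomorphism (localization_map (p := p) f).
Proof.
move=> surj ker; split.
  move=> x y; rewrite -[x]fracK -[y]fracK.
  set a := num x; set b := num y; set i := den x; set j := den y.
  have fracB (U : zmodType) (c d : U) : Defs.frac p c i - Defs.frac p d j =
      Defs.frac p (c *+ p ^ j + (- d) *+ p ^ i) (i + j).
    by rewrite -loc_addE -loc_oppE.
  by rewrite fracB !localization_map_frac fracB raddfD !raddfMn raddfN.
apply: injective_surjective_bijective => [x y|y].
  rewrite -[x]fracK -[y]fracK !localization_map_frac => /fracP [r].
  rewrite -!(raddfMn f) => /eqP; rewrite -subr_eq0 -raddfB => /eqP/ker [N].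
  rewrite mulrnBl -!mulrnA -!expnD => /eqP; rewrite subr_eq0 => /eqP e.
  by apply/fracP; exists (N + r)%N; rewrite -!addnA ![(N + _)%N]addnC.
have [x hx] := surj (num y); exists (Defs.frac p x (den y)).
by rewrite localization_map_frac hx fracK.
Qed.

End LocalizationMap.

Section ModIntMap.
Variables (m : int) (V W : zmodType) (f : {additive V -> W}).

Lemma mod_int_eq0 (T : zmodType) (x : T) :
  span_proj [set x : T | exists y : T, x = y *~ m] x = 0 <-> exists y, x = y *~ m.
Proof.
rewrite span_proj_eq0; split=> [/subgroup_spanP h|]; last exact: mem_subgroup_span.
apply: (h [set z | exists y, z = y *~ m]) => //; first by exists 0; rewrite mul0rz.
by move=> _ _ [a ->] [b ->]; exists (a - b); rewrite mulrzBl.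
Qed.

Lemma mod_int_map_proj x :
  mod_int_map (m := m) f (span_proj _ x) = span_proj _ (f x).
Proof.
apply/eqP; rewrite /mod_int_map -subr_eq0 -span_projB; apply/eqP/mod_int_eq0.
have [y e] : exists y, span_repr (span_proj [set x : V | exists y : V, x = y *~ m] x) - x
    = y *~ m.
  by apply/mod_int_eq0; rewrite span_projB span_reprK subrr.
by exists (f y); rewrite -raddfB e raddfMz.
Qed.

Lemma mod_int_map_iso : (forall y, exists x, f x = y) ->
  (forall x, f x = 0 -> exists y, x = y *~ m) ->
  group_isomorphism (mod_int_map (m := m) f).
Proof.
move=> surj ker; have morph : zmod_morphism (mod_int_map (m := m) f).
  move=> x y; rewrite -[x]span_reprK -[y]span_reprK -span_projB.
  by rewrite !mod_int_map_proj raddfB span_projB.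
split=> //; apply: injective_surjective_bijective => [x y e|y].
  apply/eqP; rewrite -subr_eq0; apply/eqP.
  have : mod_int_map (m := m) f (x - y) = 0 by rewrite morph e subrr.
  rewrite -[x - y]span_reprK mod_int_map_proj => /mod_int_eq0 [b hb].
  (* Lifting b to a turns divisibility of the image by m into an element of the kernel, which is
     divisible by m in turn. *)
  have [a ha] := surj b; rewrite -ha -raddfMz in hb.
  have /ker [c hc] : f (span_repr (x - y) - a *~ m) = 0 by rewrite raddfB hb subrr.
  apply/mod_int_eq0; exists (c + a).
  by rewrite mulrzDl -hc subrK.
have [x hx] := surj (span_repr y); exists (span_proj _ x).
by rewrite mod_int_map_proj hx span_reprK.
Qed.

End ModIntMap.

Theorem theorem1p2 (k : fieldType) (hk : perfect_field k) (n : nat)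
    (IX ID : set {mpoly k[n.+1]})
    (hX : projective_variety IX) (hXsmooth : smooth IX)
    (hD : effective_cartier_divisor IX ID)
    (hDreg : forall Z, irreducible_component ID Z -> regular Z)
    (lambda : {additive CH0_modulus IX ID -> H0_suslin IX ID})
    (hlambda : induced_by_identity lambda) :
  (forall p : nat, p \in [pchar k] ->
     group_isomorphism (@localization_map p _ _ lambda)) /\
  ([pchar k] =i pred0 -> forall m : int, m != 0 ->
     group_isomorphism (@mod_int_map m _ _ lambda)).
Proof.
split=> [p pk|k0 m m0].
  apply: localization_map_iso; first exact: (induced_surjective hlambda).
  apply: (induced_kernel_torsion hlambda) => z.
  exact: (suslin_relations_pchar hX hD pk).
apply: mod_int_map_iso; first exact: (induced_surjective hlambda).
move=> x /(induced_kernel_divisible hlambda (m := `|m|%N)) [z|y ->].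
  apply: (suslin_relations_mod hX hD).
  by rewrite ((pcharf0P k).1 k0) absz_eq0.
case: m m0 => d _ /=; first by exists y.
exists (- y).
by rewrite NegzE mulrNz mulNrz opprK.
Qed.
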